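(* Let $p$ be a prime. Let $d \ge 1$ and $n = (p-1)d - 1$ be integers. Fix some free $\mathbb{Z}/p$-action on $S^n$ and a generator $s$ of $\mathbb{Z}/p$. Let $A_i^{(j)} \subset S^n$ be closed sets, for $i \in [d]$ and $j \in [n+1]$, such that $S^n = \bigcup_{i \in [d]} \bigcup_{g \in \mathbb{Z}/p} g \cdot A_i^{(j)}$ for every $j \in [n+1]$. Suppose that $\bigcap_{k=1}^{p} s^k \cdot A_i^{(j_k)} = \emptyset$ for every $i \in [d]$ and all pairwise distinct $j_1, \dots, j_p \in [n+1]$. Then for all $s_1, \dots, s_d \in \mathbb{Z}/p$ there is a bijection $\pi \colon \{(i,g) \in [d] \times \mathbb{Z}/p : g \ne s_i\} \to [n+1]$ such that $$\bigcap_{i \in [d]} \bigcap_{g \in \mathbb{Z}/p \setminus \{s_i\}} g \cdot A_i^{(\pi(i,g))} \ne \emptyset.$$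
   Context: $[m] = \{1,\dots,m\}$. A (continuous) $\mathbb{Z}/p$-action on $S^n$ is free if $g \cdot x \ne x$ for all $g \in \mathbb{Z}/p \setminus \{0\}$ and all $x \in S^n$. For $A \subseteq S^n$ and $g \in \mathbb{Z}/p$, $g \cdot A = \{g \cdot x : x \in A\}$. The notation $s^k \cdot A$ means that the generator $s$ is applied $k$ times to $A$. *)

(* Defs.v *)
From HB Require Import structures.
From mathcomp Require Import all_boot all_order all_algebra.
From mathcomp Require Import all_fingroup all_solvable.
From mathcomp Require Import all_classical all_reals all_analysis.
Import Order.TTheory GRing.Theory Num.Theory.
Import numFieldNormedType.Exports.

Set Implicit Arguments.
Unset Strict Implicit.
Unset Printing Implicit Defensive.

Local Open Scope classical_set_scope.
Local Open Scope ring_scope.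

(* The norm `|x| of a row vector is the sup norm, so the Euclidean condition is
   written out. As a type, [sphere R n] carries the subspace topology through
   the library instance on [set_type]. *)
Definition sphere (R : realType) (n : nat) : set 'rV[R]_n.+1 :=
  [set x | \sum_(i < n.+1) x ord0 i ^+ 2 = 1].
Arguments sphere : clear implicits.

(* 'Z_p is a finGroupType through its additive group law, and the action
   notation of the library is on the right; as 'Z_p is abelian, [to x g] is the
   left action of g on x. Since 'Z_p is discrete, the action is continuous iff
   each translation is. *)
Definition continuous_action (p : nat) (X : topologicalType)
    (to : {action 'Z_p &-> X}) : Prop :=
  forall g : 'Z_p, continuous (fun x : X => to x g).

Definition free_action (p : nat) (X : Type) (to : {action 'Z_p &-> X}) : Prop :=
  forall (g : 'Z_p) (x : X), g != 0 -> to x g <> x.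

Definition translate (p : nat) (X : Type) (to : {action 'Z_p &-> X})
    (g : 'Z_p) (B : set X) : set X :=
  [set to x g | x in B].

(* Main.v *)
Require Import Defs.
From HB Require Import structures.
From mathcomp Require Import all_boot all_order all_algebra.
From mathcomp Require Import all_fingroup all_solvable.
From mathcomp Require Import all_classical all_reals all_analysis.
From mathcomp Require Import ring lra zify.
Import Order.TTheory GRing.Theory Num.Theory.
Import numFieldNormedType.Exports.

(** The theorem is a degree argument carried out with chains of tuples of points
    of the sphere ("Vietoris chains") instead of homology. Since cycles of small
    tuples of dimension below [n] bound on [S^n], the first [n + 1] terms
    [c_0, ..., c_n] of the standard resolution of the trivial module over the
    group ring of [Z/p] can be realised by arbitrarily small tuples. Subdivide
    them barycentrically and label the barycentre [x] of a [j]-dimensional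
    simplex by some [(i, g)] such that [x] lies in [g A_i^(j)], equivariantly.
    For small tuples the hypothesis on [p]-fold intersections says that no simplex
    carries all labels [(i, g)], [g] in [Z/p], so the labels map the [c_k] to
    the [d]-fold join of the boundary of a simplex on [Z/p], which is a sphere of
    dimension [n] with a free [Z/p]-action. The image of the cycle [\sum_g g c_n]
    is not zero modulo [p] (otherwise one could descend along the resolution to
    the contradiction [1 = p a]), hence it covers every facet of the join. The
    facet [{(i, g) : g <> s_i}] yields [n + 1] close points and the bijection, and
    compactness turns close points into a common point. *)

Set Implicit Arguments.
Unset Strict Implicit.
Unset Printing Implicit Defensive.

Local Open Scope ring_scope.

(** * Augmented chains of tuples and barycentric subdivision *)

(* A chain is a formal linear combination of tuples, kept as a list; two chains
   are identified when every cochain [seq X -> F] pairs equally with them. The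
   empty tuple is a simplex, so that the complex is augmented. *)
Definition chain (F : comNzRingType) (X : Type) := seq (F * seq X).

Definition pairing (F : comNzRingType) (X : Type) (f : seq X -> F)
  (c : chain F X) : F := \sum_(a <- c) a.1 * f a.2.

Fixpoint bound (F : comNzRingType) (X : Type) (t : seq X) : chain F X :=
  if t is x :: u then
    (1, u) :: [seq (- a.1, x :: a.2) | a <- bound F u]
  else [::].

Fixpoint cobound (F : comNzRingType) (X : Type) (f : seq X -> F) (t : seq X)
  : F := if t is x :: u then f u - cobound (fun v => f (x :: v)) u else 0.

Definition prefix_chain (F : comNzRingType) (X : Type) (x : X)
  (c : chain F X) : chain F X := [seq (a.1, x :: a.2) | a <- c].

Definition scale_chain (F : comNzRingType) (X : Type) (r : F)
  (c : chain F X) : chain F X := [seq (r * a.1, a.2) | a <- c].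

Definition map_chain (F : comNzRingType) (X Y : Type) (h : X -> Y)
  (c : chain F X) : chain F Y := [seq (a.1, map h a.2) | a <- c].

Definition extend (F : comNzRingType) (X Y : Type) (A : seq X -> chain F Y)
  (c : chain F X) : chain F Y := flatten [seq scale_chain a.1 (A a.2) | a <- c].

(* With [v t] the barycentre of [t], this is the barycentric subdivision of the
   [m]-tuple [t]; a [v] that labels barycentres gives the subdivision followed
   by the simplicial map induced by the labelling. *)
Fixpoint subdiv (F : comNzRingType) (X V : Type) (v : seq X -> V) (m : nat)
    (t : seq X) : chain F V :=
  if m is m'.+1 then prefix_chain (v t) (extend (subdiv F v m') (bound F t))
  else [:: (1, [::])].

(** The cone formula for a chain homotopy from the identity to the subdivision; [m] is the size of
    [t] and makes the recursion structural. *)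
Fixpoint subdiv_htpy (F : comNzRingType) (X : Type) (v : seq X -> X) (m : nat)
    (t : seq X) : chain F X :=
  if m is m'.+1 then
    prefix_chain (v t)
      ((1, t) :: scale_chain (-1) (extend (subdiv_htpy F v m') (bound F t)))
  else [::].

Section ChainTheory.
Variable F : comNzRingType.

Section Pairing.
Variables X : Type.
Implicit Types (f g : seq X -> F) (c : chain F X) (t : seq X).

Lemma pairing_nil f : pairing f [::] = 0.
Proof. by rewrite /pairing big_nil. Qed.

Lemma pairing_cons f a c : pairing f (a :: c) = a.1 * f a.2 + pairing f c.
Proof. by rewrite /pairing big_cons. Qed.

Lemma pairing_cat f c1 c2 : pairing f (c1 ++ c2) = pairing f c1 + pairing f c2.
Proof. by rewrite /pairing big_cat. Qed.

Lemma eq_pairing f g c : f =1 g -> pairing f c = pairing g c.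
Proof. by move=> fg; apply: eq_bigr => a _; rewrite fg. Qed.

Lemma pairingB f g c :
  pairing (fun t => f t - g t) c = pairing f c - pairing g c.
Proof. by rewrite /pairing -sumrB; apply: eq_bigr => a _; rewrite mulrBr. Qed.

Lemma pairingD f g c :
  pairing (fun t => f t + g t) c = pairing f c + pairing g c.
Proof. by rewrite /pairing -big_split; apply: eq_bigr => a _; rewrite mulrDr. Qed.

Lemma pairing_sum (I : Type) (r : seq I) (P : pred I) (f : I -> seq X -> F) c :
  pairing (fun t => \sum_(i <- r | P i) f i t) c =
  \sum_(i <- r | P i) pairing (f i) c.
Proof.
by rewrite /pairing exchange_big /=; apply: eq_bigr => a _; rewrite mulr_sumr.
Qed.

Lemma pairing_prefix f x c :
  pairing f (prefix_chain x c) = pairing (fun u => f (x :: u)) c.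
Proof. by rewrite /pairing big_map. Qed.

Lemma pairing_scale f r c : pairing f (scale_chain r c) = r * pairing f c.
Proof.
by rewrite /pairing big_map mulr_sumr; apply: eq_bigr => a _; rewrite mulrA.
Qed.

Lemma pairing_bound f t : pairing f (bound F t) = cobound f t.
Proof.
elim: t f => [|x u IH] f /=; first by rewrite pairing_nil.
rewrite pairing_cons /= mul1r -IH; congr (f u + _).
by rewrite /pairing big_map -sumrN; apply: eq_bigr => a _; rewrite mulNr.
Qed.

Lemma eq_cobound f g t : f =1 g -> cobound f t = cobound g t.
Proof. by move=> fg; rewrite -!pairing_bound; exact: eq_pairing. Qed.

Lemma coboundB f g t :
  cobound (fun u => f u - g u) t = cobound f t - cobound g t.
Proof. by rewrite -!pairing_bound pairingB. Qed.

Lemma coboundN f t : cobound (fun u => - f u) t = - cobound f t.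
Proof.
by rewrite -!pairing_bound /pairing -sumrN; apply: eq_bigr => a _; rewrite mulrN.
Qed.

Lemma cobound_sum (I : Type) (r : seq I) (P : pred I) (f : I -> seq X -> F) t :
  cobound (fun t => \sum_(i <- r | P i) f i t) t =
  \sum_(i <- r | P i) cobound (f i) t.
Proof. by rewrite -pairing_bound pairing_sum;
  under eq_bigr do rewrite pairing_bound. Qed.

Lemma cobound0 t : cobound (fun=> 0) t = 0 :> F.
Proof. by rewrite -pairing_bound /pairing big1 // => a _; rewrite mulr0. Qed.

Lemma cobound_cobound f t : cobound (cobound f) t = 0.
Proof.
elim: t f => [|x u IH] f //=.
by rewrite coboundB IH subr0 subrr.
Qed.

End Pairing.

Section Pairing2.
Variables X Y : Type.
Implicit Types (c : chain F X) (t : seq X).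

Lemma pairing_map (f : seq Y -> F) (h : X -> Y) c :
  pairing f (map_chain h c) = pairing (fun t => f (map h t)) c.
Proof. by rewrite /pairing big_map. Qed.

Lemma pairing_extend (f : seq Y -> F) (A : seq X -> chain F Y) c :
  pairing f (extend A c) = pairing (fun t => pairing f (A t)) c.
Proof.
elim: c => [|a c IH]; first by rewrite !pairing_nil.
by rewrite /extend /= pairing_cat pairing_scale pairing_cons -IH.
Qed.

Lemma cobound_map (f : seq Y -> F) (h : X -> Y) t :
  cobound (fun u => f (map h u)) t = cobound f (map h t).
Proof. by elim: t f => [|x u IH] f //=; rewrite -IH. Qed.

End Pairing2.

Section Support.
Variables X : eqType.
Implicit Types (f g : seq X -> F) (c : chain F X) (t : seq X).

Lemma eq_in_pairing f g c :
  (forall a, a \in c -> f a.2 = g a.2) -> pairing f c = pairing g c.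
Proof.
by move=> fg; rewrite /pairing !big_seq; apply: eq_bigr => a /fg ->.
Qed.

Lemma mem_bound t a : a \in bound F t -> subseq a.2 t /\ (size a.2).+1 = size t.
Proof.
elim: t a => [|x u IH] a //; rewrite inE => /orP[/eqP ->|].
  by split=> //; exact: subseq_cons.
by move=> /mapP[b /IH[sb zb] ->] /=; rewrite eqxx zb.
Qed.

Lemma eq_in_cobound f g t :
  (forall u, subseq u t -> (size u).+1 = size t -> f u = g u) ->
  cobound f t = cobound g t.
Proof.
move=> fg; rewrite -!pairing_bound; apply: eq_in_pairing => a /mem_bound[? ?].
exact: fg.
Qed.

Lemma mem_prefix x c a :
  a \in prefix_chain x c -> exists2 b, b \in c & a.2 = x :: b.2.
Proof. by move=> /mapP[b bc ->]; exists b. Qed.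

Lemma mem_scale r c a : a \in scale_chain r c -> exists2 b, b \in c & a.2 = b.2.
Proof. by move=> /mapP[b bc ->]; exists b. Qed.

End Support.

Section Support2.
Variables X Y : eqType.
Implicit Types c : chain F X.

Lemma mem_map_chain (h : X -> Y) c a :
  a \in map_chain h c -> exists2 b, b \in c & a.2 = map h b.2.
Proof. by move=> /mapP[b bc ->]; exists b. Qed.

Lemma mem_extend (A : seq X -> chain F Y) c a : a \in extend A c ->
  exists2 b, b \in c & exists2 e, e \in A b.2 & a.2 = e.2.
Proof.
by move=> /flattenP[/= _ /mapP[b bc ->] /mem_scale[e eA ->]]; exists b => //;
  exists e.
Qed.

End Support2.

Lemma subdivS (X V : Type) (v : seq X -> V) m t : subdiv F v m.+1 t =
  prefix_chain (v t) (extend (subdiv F v m) (bound F t)).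
Proof. by []. Qed.

Lemma subdiv_htpyS (X : Type) (v : seq X -> X) m t : subdiv_htpy F v m.+1 t =
  prefix_chain (v t)
    ((1, t) :: scale_chain (-1) (extend (subdiv_htpy F v m) (bound F t))).
Proof. by []. Qed.

(** Subdivision is a chain map: the boundary of a cone is its base minus the cone over the boundary
    of the base, and by induction the latter is a double boundary. *)
Lemma pairing_cobound_subdiv (X : eqType) (V : Type) (v : seq X -> V) m
    (t : seq X) f : size t = m.+1 ->
  pairing (cobound f) (subdiv F v m.+1 t) =
  cobound (fun u => pairing f (subdiv F v m u)) t.
Proof.
elim: m f t => [|m IH] f t st.
  rewrite /= pairing_prefix pairing_extend pairing_bound.
  by case: t st => [|x []] //= _; rewrite !pairing_cons !pairing_nil /= !subr0 !mul1r.
rewrite subdivS.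
rewrite pairing_prefix pairing_extend pairing_bound /=.
rewrite (@eq_in_cobound _ _ (fun u => pairing f (subdiv F v m.+1 u) -
   cobound (fun w => pairing (fun u => f (v t :: u)) (subdiv F v m w)) u)).
  by rewrite coboundB cobound_cobound subr0.
move=> u _ /eqP; rewrite st eqSS => /eqP su.
by rewrite pairingB IH.
Qed.

(** The homotopy identity. One cone is expanded, and the induction hypothesis on the faces reduces
    the rest to a double boundary. *)
Lemma pairing_cobound_htpy (X : eqType) (v : seq X -> X) m (t : seq X) f :
  size t = m.+1 ->
  pairing (cobound f) (subdiv_htpy F v m.+1 t) +
    cobound (fun u => pairing f (subdiv_htpy F v m u)) t
  = f t - pairing f (subdiv F v m.+1 t).
Proof.
elim: m f t => [|m IH] f t st.
  case: t st => [|x []] //= _.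
  by rewrite !pairing_cons !pairing_nil /= mul1r !subr0 /= ?addr0 ?mul1r ?subr0
    ?mul1r.
have -> : forall g, pairing g (subdiv_htpy F v m.+2 t) = g (v t :: t) -
    cobound (fun u => pairing (fun w => g (v t :: w)) (subdiv_htpy F v m.+1 u)) t.
  move=> g; rewrite subdiv_htpyS pairing_prefix pairing_cons mul1r pairing_scale
    pairing_extend.
  by rewrite pairing_bound mulN1r.
have -> : forall g, pairing g (subdiv F v m.+2 t) =
    cobound (fun u => pairing (fun w => g (v t :: w)) (subdiv F v m.+1 u)) t.
  by move=> g; rewrite subdivS pairing_prefix pairing_extend pairing_bound.
set g := fun w => f (v t :: w).
rewrite [cobound f (v t :: t)]/= -/g.
rewrite (@eq_in_cobound _
  (fun u => pairing (fun w => cobound f (v t :: w)) (subdiv_htpy F v m.+1 u))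
  (fun u => pairing f (subdiv_htpy F v m.+1 u) -
    (g u - pairing g (subdiv F v m.+1 u) -
     cobound (fun u => pairing g (subdiv_htpy F v m u)) u))).
  rewrite !coboundB cobound_cobound subr0 !opprB.
  set a := cobound g t; set b := cobound _ t; set c := cobound _ t.
  by ring.
move=> u _ /eqP; rewrite st eqSS => /eqP su.
by rewrite -IH // addrK /= pairingB.
Qed.

End ChainTheory.

(** * Alternating cochains and the group ring *)

Definition Zp_action (p : nat) (X : Type) (act : 'Z_p -> X -> X) : Prop :=
  (forall x, act 0 x = x) /\ (forall g h x, act (g + h) x = act g (act h x)).

(* The elements [s - 1] (for [b = true], with [s] the generator [1 : 'Z_p]) and
   [\sum_g g] (for [b = false]) of the group ring, acting on cochains. *)
Definition group_ring_op (F : comNzRingType) (p : nat) (X : Type)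
    (act : 'Z_p -> X -> X) (b : bool) (f : seq X -> F) (t : seq X) : F :=
  if b then f (map (act 1) t) - f t else \sum_(g : 'Z_p) f (map (act g) t).

(** The second clause does not follow from the first when 2 is a zero divisor in [F], as in the case
    [p = 2]. *)
Definition alternating (F : comNzRingType) (V : Type) (f : seq V -> F) : Prop :=
  (forall a x y b, f (a ++ x :: y :: b) = - f (a ++ y :: x :: b)) /\
  (forall a x b, f (a ++ x :: x :: b) = 0).

Section Alternating.
Variables (F : comNzRingType).

Lemma alternating_cons (V : Type) (f : seq V -> F) x :
  alternating f -> alternating (fun u => f (x :: u)).
Proof.
by case=> f1 f2; split=> [a|a] *; [exact: (f1 (x :: a))|exact: (f2 (x :: a))].
Qed.

Lemma alternating_map (V W : Type) (h : W -> V) (f : seq V -> F) :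
  alternating f -> alternating (fun u => f (map h u)).
Proof. by case=> f1 f2; split=> *; rewrite !map_cat /= ?f2 // f1. Qed.

Lemma alternatingB (V : Type) (f g : seq V -> F) :
  alternating f -> alternating g -> alternating (fun u => f u - g u).
Proof.
case=> f1 f2 [g1 g2]; split=> *; last by rewrite f2 g2 subr0.
by rewrite f1 g1 opprB opprK addrC.
Qed.

Lemma alternating_sum (V I : Type) (r : seq I) (P : pred I) (f : I -> seq V -> F) :
  (forall i, alternating (f i)) -> alternating (fun u => \sum_(i <- r | P i) f i u).
Proof.
move=> altf; split=> *; last by rewrite big1 // => i _; rewrite (altf i).2.
by rewrite -sumrN; apply: eq_bigr => i _; rewrite (altf i).1.
Qed.

Lemma alternating0 (V : Type) : alternating (fun _ : seq V => 0 : F).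
Proof. by split=> *; rewrite ?oppr0. Qed.

(** Permuting entries preserves the vertex set, so a cochain may be cut off by a condition on that
    set and stay alternating. *)
Lemma alternating_set (V : finType) (f : {set V} -> seq V -> F) :
  (forall S, alternating (f S)) -> alternating (fun u => f [set x in u]%SET u).
Proof.
move=> altf; split=> [a x y b|a x b]; last by rewrite (altf _).2.
rewrite (altf _).1; congr (- f _ _); apply/setP => z.
by rewrite !inE !mem_cat !inE; case: (z == x); case: (z == y); rewrite /= ?orbT.
Qed.

Lemma alternating_cobound (V : Type) (f : seq V -> F) :
  alternating f -> alternating (cobound f).
Proof.
move=> altf; split=> a.
  elim: a f altf => [|z a IH] f altf x y b /=; last first.
    by rewrite altf.1 IH ?opprD //; exact: alternating_cons.
  rewrite (eq_cobound b (g := fun v => - f (y :: x :: v))).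
    by rewrite coboundN; ring.
  by move=> v; exact: (altf.1 [::]).
elim: a f altf => [|z a IH] f altf x b /=; last first.
  by rewrite altf.2 IH ?subr0 //; exact: alternating_cons.
rewrite (eq_cobound b (g := fun=> 0)) ?cobound0; first by ring.
by move=> v; exact: (altf.2 [::]).
Qed.

Section Swap.
Variable V : eqType.
Implicit Types (u : seq V) (f : seq V -> F).

Lemma alternating_to_front x u : x \in u ->
  exists (e : F) (w : seq V), {subset w <= u} /\
    forall f, alternating f -> f u = e * f (x :: w).
Proof.
elim: u => // y u IH; rewrite inE.
have [->|xy] /= := eqVneq x y.
  move=> _; exists 1, u; split; last by move=> f _; rewrite mul1r.
  by move=> z zu; rewrite inE zu orbT.
move=> /IH[e [w [wu He]]]; exists (- e), (y :: w); split.
  by move=> z; rewrite !inE => /orP[->//|/wu ->]; rewrite orbT.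
move=> f altf; have /= -> := He _ (alternating_cons y altf).
by have /= -> := altf.1 [::] y x w; rewrite mulrN mulNr.
Qed.

Lemma alternating_uniq u f : alternating f -> f u != 0 -> uniq u.
Proof.
move=> altf; apply: contraR; elim: u f altf => //= x u IH f altf.
rewrite negb_and negbK => /orP[xu|uu]; last first.
  exact: (IH _ (alternating_cons x altf)).
have [e [w [_ He]]] := alternating_to_front xu.
have /= -> := He _ (alternating_cons x altf).
by have /= -> := altf.2 [::] x w; rewrite mulr0.
Qed.

End Swap.

End Alternating.

Section Phase.
Variables (p : nat) (Y : choiceType) (act : 'Z_p -> Y -> Y).
Hypothesis actP : Zp_action act.

Lemma Zp_actK g : cancel (act g) (act (- g)).
Proof. by move=> x; rewrite -actP.2 addNr actP.1. Qed.

(* A free orbit is a torsor; choosing a base point in each orbit identifies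
   every orbit with the group. *)
Lemma exists_phase (P : Y -> Prop) (y0 : Y) :
  (forall g y, P y -> P (act g y)) ->
  (forall g y, P y -> act g y = y -> g = 0) ->
  exists phase : Y -> 'Z_p, forall g y, P y -> phase (act g y) = phase y + g.
Proof.
move=> Pact freeP.
pose orb y := [set z | exists g, z = act g y]%classic.
have orbE g y : orb (act g y) = orb y.
  apply/seteqP; split=> z [h ->]; first by exists (h + g); rewrite actP.2.
  by exists (h - g); rewrite -actP.2 subrK.
pose rep y := xget y0 (orb y).
have repE y : orb y (rep y).
  by apply: (@xgetPex _ y0 (orb y)); exists y, 0; rewrite actP.1.
pose phase y := xget (0 : 'Z_p) [set h | y = act h (rep y)]%classic.
have phaseE y : y = act (phase y) (rep y).
  apply: (@xgetPex _ (0 : 'Z_p) [set h | y = act h (rep y)]%classic).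
  by have [h hE] := repE y; exists (- h); rewrite /= hE Zp_actK.
exists phase => g y Py.
have repG : rep (act g y) = rep y by rewrite /rep orbE.
have := phaseE (act g y);
  rewrite repG {1}(phaseE y) -actP.2 => /(congr1 (act (- (g + phase y)))).
rewrite -actP.2 addNr actP.1 -actP.2 => /esym /freeP.
have [h hE] := repE y; rewrite {1}hE => /(_ (Pact _ _ Py)).
by move=> /eqP; rewrite addrC subr_eq0 => /eqP ->; rewrite addrC.
Qed.

End Phase.

Section GroupRing.
Variables (F : comNzRingType) (p : nat) (X : Type) (act : 'Z_p -> X -> X).
Hypothesis actP : Zp_action act.
Hypothesis pF : p%:R = 0 :> F.
Hypothesis p_gt1 : (1 < p)%N.
Local Notation op := (group_ring_op act).
Implicit Types f : seq X -> F.

Lemma Zp_action_seq : Zp_action (fun g => map (act g)).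
Proof.
split=> [t|g h t]; last by rewrite -map_comp; apply: eq_map => x; rewrite /= actP.2.
by rewrite (eq_map (g := id)) ?map_id // => x; rewrite actP.1.
Qed.

Let mapD g h t : map (act (g + h)) t = map (act g) (map (act h) t).
Proof. exact: Zp_action_seq.2. Qed.

Let map0 t : map (act 0) t = t.
Proof. exact: Zp_action_seq.1. Qed.

Lemma sumr_const_Zp (r : F) : \sum_(g : 'Z_p) r = 0.
Proof. by rewrite sumr_const card_ord Zp_cast // -mulr_natr pF mulr0. Qed.

Lemma group_ring_op_cobound b f t :
  cobound (op b f) t = op b (cobound f) t.
Proof.
case: b; first by rewrite /op coboundB cobound_map.
by rewrite /op cobound_sum; apply: eq_bigr => g _; rewrite cobound_map.
Qed.

(** The square of the norm is [p] times the norm. *)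
Lemma norm_norm f t : op false (op false f) t = 0.
Proof.
rewrite /op -[RHS](sumr_const_Zp (op false f t)); apply: eq_bigr => g _.
rewrite /op [RHS](reindex_inj (addIr g)).
by apply: eq_bigr => h _; rewrite mapD.
Qed.

Lemma norm_diff b f t : op b (op (~~ b) f) t = 0.
Proof.
case: b => /=; rewrite /op.
  apply/eqP; rewrite subr_eq0; apply/eqP; rewrite [RHS](reindex_inj (addIr 1)).
  by apply: eq_bigr => h _; rewrite mapD.
rewrite sumrB; apply/eqP; rewrite subr_eq0; apply/eqP.
rewrite [RHS](reindex_inj (addrI 1)).
by apply: eq_bigr => h _; rewrite mapD.
Qed.

End GroupRing.

Definition group_ring_chain (F : comNzRingType) (p : nat) (X : Type)
    (act : 'Z_p -> X -> X) (b : bool) (c : chain F X) : chain F X :=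
  if b then map_chain (act 1) c ++ scale_chain (-1) c
  else flatten [seq map_chain (act g) c | g <- enum 'Z_p].

Lemma pairing_group_ring_chain (F : comNzRingType) p X (act : 'Z_p -> X -> X) b
    (c : chain F X) f :
  pairing f (group_ring_chain act b c) = pairing (group_ring_op act b f) c.
Proof.
case: b; rewrite /group_ring_chain /group_ring_op.
  by rewrite pairing_cat pairing_map pairing_scale mulN1r pairingB.
rewrite pairing_sum -[RHS]big_enum /=; elim: (enum 'Z_p) => [|g r IH] /=.
  by rewrite big_nil pairing_nil.
by rewrite pairing_cat IH big_cons pairing_map.
Qed.

Lemma mem_group_ring_chain (F : comNzRingType) p (X : eqType)
    (act : 'Z_p -> X -> X) b (c : chain F X) a : Zp_action act ->
  a \in group_ring_chain act b c -> exists g, exists2 e,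
    e \in c & a.2 = map (act g) e.2.
Proof.
move=> actP; case: b.
  rewrite mem_cat => /orP[/mem_map_chain|/mem_scale] [e ec ->]; first by exists 1, e.
  by exists 0, e => //; rewrite (Zp_action_seq actP).1.
by move=> /flattenP[/= _ /mapP[g _ ->] /mem_map_chain[e ec ->]]; exists g, e.
Qed.

(** * The join of boundaries of simplices *)

Definition shift (p d : nat) (g : 'Z_p) (v : 'I_d * 'Z_p) : 'I_d * 'Z_p :=
  (v.1, v.2 + g).

(* The simplices of the [d]-fold join of the boundary of the simplex on ['Z_p],
   a sphere of dimension [d * (p - 1) - 1]. *)
Definition join_simplex (p d : nat) (u : seq ('I_d * 'Z_p)) : Prop :=
  forall i, exists g, (i, g) \notin u.

Definition facet (p d : nat) (s : 'I_d -> 'Z_p) (u : seq ('I_d * 'Z_p)) : bool :=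
  [forall v : 'I_d * 'Z_p, (v \in u) == (v.2 != s v.1)].

Section Join.
Variables (F : comNzRingType) (p d : nat).
Hypothesis p_prime : prime p.
Local Notation V := ('I_d * 'Z_p)%type.
Local Notation shf := (@shift p d).
Local Notation op := (group_ring_op shf).

Let p_gt1 : (1 < p)%N := prime_gt1 p_prime.

Lemma Zp_action_shift : Zp_action shf.
Proof.
split=> [[i a]|g h [i a]]; rewrite /shift /= ?addr0 //.
by rewrite addrA addrAC.
Qed.

Lemma shiftK g (v : V) : shf g (shf (- g) v) = v.
Proof. by rewrite -Zp_action_shift.2 subrr Zp_action_shift.1. Qed.

Lemma facetP s (u : seq V) :
  reflect (forall v, (v \in u) = (v.2 != s v.1)) (facet s u).
Proof. by apply: (iffP forallP) => H v; apply/eqP; have := H v. Qed.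

Lemma facet_inj s1 s2 (u : seq V) : facet s1 u -> facet s2 u -> s1 =1 s2.
Proof.
move=> /facetP f1 /facetP f2 i; apply/eqP.
by have := f1 (i, s1 i); rewrite f2 /= eqxx => /negbFE.
Qed.

Lemma join_simplex_sub (u w : seq V) : {subset u <= w} -> join_simplex w ->
  join_simplex u.
Proof. by move=> uw pw i; have [g gw] := pw i; exists g; apply: contra gw => /uw. Qed.

Lemma mem_map_shift g (u : seq V) v : (v \in map (shf g) u) = (shf (- g) v \in u).
Proof.
rewrite -{1}[v](shiftK g) mem_map //.
exact: can_inj (Zp_actK Zp_action_shift g).
Qed.

Lemma join_simplex_shift g (u : seq V) : join_simplex u ->
  join_simplex (map (shf g) u).
Proof.
move=> pu i; have [h hu] := pu i; exists (h + g).
by rewrite mem_map_shift /shift /= addrK.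
Qed.

Lemma Zp_unit (g : 'Z_p) : g != 0 -> g \is a GRing.unit.
Proof.
move=> g0; rewrite -[g]natr_Zp unitZpE // prime_coprime //; apply/negP => pg.
move/eqP: g0; apply; rewrite -[g]natr_Zp; apply/val_inj/eqP.
by rewrite /= val_Zp_nat.
Qed.

Lemma Zp_generated (g h : 'Z_p) : g != 0 -> exists k : nat, h = g *+ k.
Proof.
move=> /Zp_unit gu; exists (val (g^-1 * h)).
by rewrite -mulr_natr natr_Zp mulrA mulrV ?mul1r.
Qed.

(** Freeness: a nonzero [g] generates [Z/p], so a vertex set fixed by [g] contains all [(i, h)] once
    it contains one of them. The phase depends on the vertex set only, so that alternating cochains
    can be built from it. *)
Lemma exists_set_phase : exists phase : {set V} -> 'Z_p,
  forall g (u : seq V), u != [::] -> join_simplex u ->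
    phase [set x in map (shf g) u]%SET = phase [set x in u]%SET + g.
Proof.
pose act g (S : {set V}) : {set V} := [set shf g v | v in S]%SET.
have inact g S v : (v \in act g S) = (shf (- g) v \in S).
  rewrite -{1}[v](shiftK g) mem_imset //.
  exact: can_inj (Zp_actK Zp_action_shift g).
pose P (S : {set V}) := (exists v, v \in S) /\ join_simplex (enum S).
have actP : Zp_action act.
  split=> [S|g h S]; apply/setP => v; rewrite !inact.
    by rewrite oppr0 Zp_action_shift.1.
  by rewrite -Zp_action_shift.2 opprD addrC.
have [||phase phaseE] := exists_phase actP (P := P) (finset.set0 : {set V}).
- move=> g S [[v vS] pS]; split.
    by exists (shf g v); rewrite inact -Zp_action_shift.2 addNr Zp_action_shift.1.
  move=> i; have [h hS] := pS i; exists (h + g).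
  by move: hS; rewrite !mem_enum inact /shift /= addrK.
- move=> g S [[[i a] vS] pS] gS; apply: contrapT => /eqP g0.
  have [h] := pS i; rewrite mem_enum => /negP; apply.
  have [k hk] := Zp_generated (h - a) g0.
  have -> : h = a + g *+ k by rewrite -hk addrC subrK.
  elim: k {hk} => [|k IH]; first by rewrite addr0.
  by rewrite -gS inact /shift /= mulrSr addrA addrK.
exists phase => g u u0 pu; rewrite -phaseE.
  congr phase; apply/setP => v.
  by rewrite inact !inE mem_map_shift.
split.
  by case: u u0 {pu} => // v u _; exists v; rewrite !inE eqxx.
by apply: join_simplex_sub pu => v; rewrite mem_enum inE.
Qed.

Let mapD g h (u : seq V) : map (shf (g + h)) u = map (shf g) (map (shf h) u).
Proof. exact: (Zp_action_seq Zp_action_shift).2. Qed.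

Let map0 (u : seq V) : map (shf 0) u = u.
Proof. exact: (Zp_action_seq Zp_action_shift).1. Qed.

(* The cochains of the join form a free module over the group ring. *)
Lemma group_ring_op_exact b m (phi : seq V -> F) : alternating phi ->
  (forall u, size u = m.+1 -> join_simplex u -> op b phi u = 0) ->
  exists2 psi, alternating psi &
    forall u, size u = m.+1 -> join_simplex u -> op (~~ b) psi u = phi u.
Proof.
move=> altphi opphi; have [phase phaseE] := exists_set_phase.
have {}phaseE g (u : seq V) : size u = m.+1 -> join_simplex u ->
    phase [set x in map (shf g) u]%SET = phase [set x in u]%SET + g.
  by move=> su; apply: phaseE; rewrite -size_eq0 su.
case: b opphi => opphi.
  (* An invariant cochain is the norm of its restriction to the simplices of phase 0, since each
     orbit of vertex sets contains exactly one of these. *)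
  pose f (S : {set V}) u := if phase S == 0 then phi u else 0.
  exists (fun u => f [set x in u]%SET u).
    by apply: alternating_set => S; rewrite /f; case: (phase S == 0) => //;
      exact: alternating0.
  move=> u su pu /=; rewrite /group_ring_op.
  rewrite (bigD1 (- phase [set x in u]%SET)) //= [X in _ + X]big1 => [|g gne];
    last first.
    rewrite /f phaseE // addr_eq0; case: eqP => // E.
    by rewrite E opprK eqxx in gne.
  rewrite addr0 /f phaseE // subrr eqxx.
  have inv k : phi (map (shf k%:R) u) = phi u.
    elim: k => [|k IH]; first by rewrite map0.
    have := opphi (map (shf k%:R) u).
    rewrite size_map => /(_ su (join_simplex_shift _ pu)) /eqP.
    by rewrite /group_ring_op subr_eq0 -mapD -mulrS IH => /eqP.
  by rewrite -[- _]natr_Zp inv.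
(* Summation along the orbit over the phases below that of [u]; one shift adds the term [phi u].
   When the phase wraps around, the vanishing of the full sum gives the same result. *)
pose f (S : {set V}) u :=
  \sum_(0 <= l < val (phase S)) phi (map (shf (l%:R - phase S)) u).
exists (fun u => f [set x in u]%SET u).
  apply: alternating_set => S; apply: alternating_sum => l.
  exact: alternating_map.
move=> u su pu /=; rewrite /group_ring_op /f phaseE //.
set q := phase _; pose h (l : nat) := phi (map (shf (l%:R - q)) u).
rewrite (eq_bigr h) => [|l _]; last by rewrite -mapD /h opprD addrA subrK.
rewrite -/h [in X in _ - X](eq_bigr h) //.
have hq : h (val q) = phi u by rewrite /h natr_Zp subrr map0.
have qlt := ltn_ord q.
case: (ltnP (val q).+1 (Zp_trunc p).+2) => qp.
  have -> : val (q + 1) = (val q).+1.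
    by rewrite /= [(1 %% _)%N]modn_small // addn1 modn_small.
  by rewrite big_nat_recr //= hq addrAC subrr add0r.
have qE : (val q).+1 = (Zp_trunc p).+2 by apply/eqP; rewrite eqn_leq qlt qp.
have -> : val (q + 1) = 0%N.
  by rewrite /= [(1 %% _)%N]modn_small // addn1 qE modnn.
rewrite big_geq // sub0r -hq; apply/eqP.
rewrite eq_sym -subr_eq0 opprK addrC -big_nat_recr //= qE big_mkord.
apply/eqP; rewrite -[RHS](opphi _ su pu) /group_ring_op [RHS](reindex_inj (addIr (-
  q))) /=.
by apply: eq_bigr => g _; rewrite /h natr_Zp.
Qed.

End Join.

(** * Top-dimensional cycles of the join and the facets they cover *)

Section JoinDegree.
Variables (F : comNzRingType) (p d : nat).
Hypothesis p_prime : prime p.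
Local Notation V := ('I_d * 'Z_p)%type.
Local Notation shf := (@shift p d).
Local Notation op := (group_ring_op shf).

Let p_gt1 : (1 < p)%N := prime_gt1 p_prime.

Lemma facet_mask (s : 'I_d -> 'Z_p) (psi : seq V -> F) :
  alternating psi -> alternating (fun u => if facet s u then psi u else 0).
Proof.
move=> altpsi.
pose f (S : {set V}) u := if [forall v : V,
  (v \in S) == (v.2 != s v.1)] then psi u else 0.
have -> : (fun u => if facet s u then psi u else 0) = (fun u => f [set x in u]%SET u).
  by apply/funext => u; rewrite /f /facet; under [in RHS]eq_forallb do rewrite inE.
apply: alternating_set => S; rewrite /f.
by case: [forall v, _] => //; exact: alternating0.
Qed.

(* Adjacent facets differ by the coboundary of their common ridge, so a cycle
   that avoids one facet avoids them all. *)
Lemma cycle_avoiding_facet (C : chain F V) (s : 'I_d -> 'Z_p) (m : nat) :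
  (forall a, a \in C -> size a.2 = m /\ join_simplex a.2) ->
  (forall f, pairing (cobound f) C = 0) ->
  (forall a, a \in C -> ~~ facet s a.2) ->
  forall s' psi, alternating psi -> (forall u, psi u != 0 -> facet s' u) ->
    pairing psi C = 0.
Proof.
move=> CP cyc nofacet s'.
have [k] := ubnP #|[pred i | s' i != s i]|.
elim: k s' => // k IH s' ltk psi altpsi psis'.
have [/existsP[i si]|ss] := boolP [exists i, s' i != s i]; last first.
  rewrite /pairing big_seq big1 // => a aC.
  have : ~~ facet s' a.2.
    apply: contra (nofacet _ aC) => /facetP fs; apply/facetP => v; rewrite fs.
    by move: ss; rewrite negb_exists => /forallP/(_ v.1); rewrite negbK => /eqP ->.
  by apply: contraNeq => a0; apply: psis'; apply: contraNneq a0 => ->; rewrite mulr0.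
pose s2 j := if j == i then s i else s' j.
pose eta u := psi ((i, s i) :: u).
(* Subtracting a coboundary leaves the pairing with a cycle unchanged. The terms cancel on simplices
   through [(i, s i)]; elsewhere only the facet of [s2] survives, and [s2] agrees with [s] at one
   more index. *)
pose theta u := psi u - cobound eta u.
have alteta : alternating eta by exact: alternating_cons.
have alttheta : alternating theta.
  by apply: alternatingB => //; exact: alternating_cobound.
have thetaE u : size u = m -> join_simplex u -> ~~ facet s2 u -> theta u = 0.
  move=> su pu nf; have [wu|wu] := boolP ((i, s i) \in u).
    have [e [w [_ He]]] := alternating_to_front F wu.
    rewrite (He _ alttheta) /theta /eta /=.
    rewrite (@eq_cobound _ _ _ (fun=> 0)) => [|v]; last by exact: (altpsi.2 [::]).
    by rewrite cobound0 subr0 subrr mulr0.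
  have -> : theta u = - cobound eta u.
    rewrite /theta; case: (eqVneq (psi u) 0) => [->|/psis'/facetP fu];
      first by rewrite sub0r.
    by move: wu; rewrite fu /= eq_sym si.
  apply/eqP; rewrite oppr_eq0; apply: contraR nf => c0.
  have uu : uniq u.
    apply: (alternating_uniq alttheta); rewrite /theta.
    case: (eqVneq (psi u) 0) => [->|/psis'/facetP fu];
      first by rewrite sub0r oppr_eq0.
    by move: wu; rewrite fu /= eq_sym si.
  have [w [wsub sw fw]] : exists w, [/\ subseq w u, (size w).+1 = size u & psi ((i,
    s i) :: w) != 0].
    apply: contrapT => H; move/eqP: c0; apply.
    rewrite -(@cobound0 F _ u); apply: eq_in_cobound => w w1 w2.
    by apply: contrapT => /eqP w3; apply: H; exists w.
  move/psis'/facetP: fw => fw.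
  have wu' := mem_subseq wsub.
  have inu v : v.2 != s' v.1 -> v != (i, s i) -> v \in u.
    by move=> v1 v2; apply: wu'; have := fw v; rewrite inE v1 (negPf v2).
  (* The one entry of [u] beyond its face [w] must be [(i, s' i)]; otherwise the distinct entries of
     [u] would all lie in [w]. *)
  have s'iu : (i, s' i) \in u.
    apply: contraT => niu.
    have : {subset u <= w}.
      move=> [j g] vu.
      have jg : (j, g) != (i, s i) by apply: contraNneq wu => <-.
      have := fw (j, g); rewrite inE (negPf jg) /= => ->.
      apply: contraNneq niu => gE.
      have [ji|ji] := eqVneq j i; first by rewrite -ji -gE.
      have [h hu] := pu j.
      case: (eqVneq h (s' j)) => [hs|hs]; first by rewrite -gE in hs;
        rewrite hs vu in hu.
      case/negP: hu; apply: inu => //=.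
      by rewrite xpair_eqE (negPf ji).
    by move=> /(uniq_leq_size uu); rewrite -sw ltnn.
  apply/facetP => -[j g] /=; rewrite /s2.
  have [->|ji] := eqVneq j i.
    have [->|gs] /= := eqVneq g (s i); first exact: negbTE.
    have [->//|gs'] := eqVneq g (s' i).
    by apply: inu => //=; rewrite xpair_eqE (negPf gs) andbF.
  have [->|gs] /= := eqVneq g (s' j); last by apply: inu => //=;
    rewrite xpair_eqE (negPf ji).
  apply/negP => ju; have [h] := pu j => /negP; apply.
  case: (eqVneq h (s' j)) => [->//|hs].
  by apply: inu => //=; rewrite xpair_eqE (negPf ji).
have -> : pairing psi C = pairing (fun u => if facet s2 u then theta u else 0) C.
  rewrite -[LHS]subr0 -[X in _ - X](cyc eta) -pairingB;
    apply: eq_in_pairing => a /CP[sa pa].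
  by rewrite /=; case: ifPn => [_|/(thetaE _ sa pa) <-].
apply: (IH s2).
- rewrite -ltnS; apply: leq_trans ltk;
    rewrite ltnS [X in (_ < X)%N](cardD1 i) !inE si add1n ltnS.
  apply: subset_leq_card; apply/fintype.subsetP => j; rewrite !inE /s2.
  by case: (eqVneq j i) => [->|]; rewrite ?eqxx.
- exact: facet_mask.
- by move=> u; case: ifP => // _; rewrite eqxx.
Qed.

Lemma size_facet_enum (s : 'I_d -> 'Z_p) :
  size (enum [pred v : V | v.2 != s v.1]) = (d * (p - 1))%N.
Proof.
rewrite -cardE -[X in _ = (_ * (X - 1))%N](Zp_cast p_gt1).
rewrite -sum1_card (partition_big fst predT) //=.
rewrite -[d in RHS]card_ord -sum_nat_const; apply: eq_bigr => i _.
rewrite subn1 -[X in _ = X.-1](card_ord (Zp_trunc p).+2) -(cardC1 (s i)) -sum1_card.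
rewrite (reindex_onto (fun g => (i, g)) snd) /=; last first.
  by move=> [j g] /= /andP[_ /eqP ->].
by apply: eq_bigl => g; rewrite !inE !eqxx !andbT.
Qed.

(** A simplex misses some [(i, s i)] for each [i]; with [d * (p - 1)] distinct entries it has no
    room to miss another vertex. *)
Lemma join_simplex_facet (u : seq V) : size u
  = (d * (p - 1))%N -> uniq u -> join_simplex u ->
  exists s : {ffun 'I_d -> 'Z_p}, facet s u.
Proof.
move=> su uu /choice[s sE]; exists (finfun s).
have sub : {subset u <= enum [pred v : V | v.2 != s v.1]}.
  move=> [j g] vu; rewrite mem_enum inE /=; apply: contraNneq (sE j) => <-.
  exact: vu.
have [|_ eqE] := uniq_min_size uu sub; first by rewrite size_facet_enum su.
by apply/facetP => v; rewrite eqE mem_enum inE ffunE.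
Qed.

Lemma facet_uniq (s : 'I_d -> 'Z_p) (u : seq V) :
  size u = (d * (p - 1))%N -> facet s u -> uniq u.
Proof.
move=> su /facetP fu; apply: (leq_size_uniq (enum_uniq [pred v : V | v.2 != s v.1])).
  by move=> v; rewrite mem_enum inE fu.
by rewrite size_facet_enum su.
Qed.

(** On simplices of full size an alternating cochain is the sum of its restrictions to the facets,
    and [cycle_avoiding_facet] applies to each. *)
Lemma cycle_avoiding_facet_eq0 (C : chain F V) (s : 'I_d -> 'Z_p) :
  (forall a, a \in C -> size a.2 = (d * (p - 1))%N /\ join_simplex a.2) ->
  (forall f, pairing (cobound f) C = 0) ->
  (forall a, a \in C -> ~~ facet s a.2) ->
  forall psi, alternating psi -> pairing psi C = 0.
Proof.
move=> CP cyc nofacet psi altpsi.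
pose f (s' : {ffun 'I_d -> 'Z_p}) u := if facet s' u then psi u else 0.
rewrite (@eq_in_pairing _ _ _ (fun u => \sum_(s' : {ffun 'I_d -> 'Z_p}) f s' u)).
  rewrite pairing_sum big1 // => s' _.
  apply: (cycle_avoiding_facet CP cyc nofacet (s' := s') (facet_mask s' altpsi)) => u.
  by case: ifP => // _; rewrite eqxx.
move=> a /CP[sa pa].
have [ps0|ps0] := eqVneq (psi a.2) 0.
  by rewrite ps0 big1 // => s' _; rewrite /f ps0 if_same.
have [s' fs'] := join_simplex_facet sa (alternating_uniq altpsi ps0) pa.
rewrite (bigD1 s') //= [X in _ + X]big1 ?addr0 => [|s2 ss2]; first by rewrite /f fs'.
rewrite /f ifF //; apply: contraNF ss2 => fs2.
by apply/eqP/ffunP => j; exact: (facet_inj fs2 fs').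
Qed.

End JoinDegree.

(** * Simplices mapped onto a facet *)

(* The first [n + 1] chains of the standard resolution of the trivial module
   over the group ring of [Z/p], realised by tuples in [P]. *)
Record resolution (F : comNzRingType) (p : nat) (X : eqType)
    (act : 'Z_p -> X -> X) (x0 : X) (P : seq X -> Prop) (n : nat)
    (c : nat -> chain F X) : Prop := Resolution {
  resolution0 : c 0%N = [:: (1, [:: x0])];
  resolution_size : forall k a, (k <= n)%N -> a \in c k -> size a.2 = k.+1;
  resolution_in : forall k a, (k <= n)%N -> a \in c k -> P a.2;
  resolution_bound : forall k f, (k < n)%N ->
    pairing (cobound f) (c k.+1) = pairing (group_ring_op act (odd k.+1) f) (c k)
}.

Lemma sum_Zp2 (F : comNzRingType) p (h : 'Z_p -> F) : p = 2 ->
  \sum_g h g = h 0 + h 1.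
Proof.
move=> p2; rewrite p2 in h *; rewrite big_ord_recl big_ord1; congr (h _ + h _).
exact/val_inj.
Qed.

Section ColorfulDegree.
Variables (F : comNzRingType) (p d n : nat) (X : eqType).
Variables (act : 'Z_p -> X -> X) (x0 : X).
Hypothesis p_prime : prime p.
Hypothesis pF : p%:R = 0 :> F.
Hypothesis actP : Zp_action act.
Hypothesis nE : n.+1 = (d * (p - 1))%N.
Local Notation V := ('I_d * 'Z_p)%type.
Local Notation shf := (@shift p d).
Local Notation op := (group_ring_op act).

Variable label : nat -> X -> V.
Hypothesis label_shift : forall j g x, label j (act g x) = shf g (label j x).

Let p_gt1 : (1 < p)%N := prime_gt1 p_prime.

(** The first entry of a tuple stands in for its barycentre: this choice commutes with the action,
    and the points of a small tuple are all close. The size selects the index [j], so a flag of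
    faces uses each index once. *)
Let color (t : seq X) : V := label (size t).-1 (head x0 t).

Let colorM t g : t != [::] -> color (map (act g) t) = shf g (color t).
Proof. by case: t => // x t _; rewrite /color /= size_map label_shift. Qed.

(** A simplex of the subdivision is a flag with one face in each dimension; the largest face comes
    first, hence the reversal. *)
Lemma mem_subdiv_color m t a : size t = m -> a \in subdiv F color m t ->
  exists2 y : nat -> X, (forall j, (j < m)%N -> y j \in t) &
    a.2 = rev [seq label j (y j) | j <- iota 0 m].
Proof.
elim: m t a => [|m IH] t a st.
  by rewrite inE => /eqP ->; exists (fun=> x0).
rewrite subdivS => /mem_prefix[b /mem_extend[e et [e' e'e be']] ->].
have [sub se] := mem_bound et.
rewrite st in se; case: se => se.
have [y yt ey] := IH _ _ se e'e.
case: t st sub {et} => // x t [st] sub.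
exists (fun j => if j == m then x else y j) => [j|].
  rewrite ltnS leq_eqVlt; case: eqVneq => [_ _|_ /= /yt ye];
    first by rewrite inE eqxx.
  exact: (mem_subseq sub).
rewrite -[X in iota 0 X]addn1 iotaD map_cat rev_cat /= add0n eqxx be' ey /color /=
  st; congr (_ :: _).
congr rev; apply/eq_in_map => j; rewrite mem_iota add0n => /andP[_ jm].
by rewrite ifF // (ltn_eqF jm).
Qed.

Lemma pairing_subdiv_shift m t g (f : seq V -> F) : size t = m ->
  pairing f (subdiv F color m (map (act g) t)) =
  pairing (fun u => f (map (shf g) u)) (subdiv F color m t).
Proof.
elim: m t f => [|m IH] t f st; first by rewrite /= !pairing_cons !pairing_nil.
rewrite !subdivS !pairing_prefix !pairing_extend !pairing_bound -cobound_map.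
rewrite colorM; last by rewrite -size_eq0 st.
apply: eq_in_cobound => u _; rewrite st => -[su].
by rewrite IH.
Qed.

Lemma pairing_op_subdiv b m t (f : seq V -> F) : size t = m ->
  op b (fun t => pairing f (subdiv F color m t)) t =
  pairing (group_ring_op shf b f) (subdiv F color m t).
Proof.
move=> st; case: b; rewrite /group_ring_op.
  by rewrite pairing_subdiv_shift // pairingB.
by rewrite pairing_sum; apply: eq_bigr => g _; rewrite pairing_subdiv_shift.
Qed.

Variables (P : seq X -> Prop) (c : nat -> chain F X).
Hypothesis cP : resolution act x0 P n c.

Hypothesis P_join : forall k t g y, (k <= n)%N -> P t ->
  (forall j, (j < k.+1)%N -> y j \in map (act g) t) ->
  join_simplex [seq label j (y j) | j <- iota 0 k.+1].

Let join_simplex_rev (u : seq V) : join_simplex u -> join_simplex (rev u).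
Proof. by apply: join_simplex_sub => v; rewrite mem_rev. Qed.

Let mem_subdiv_join k a e : (k <= n)%N -> a \in c k ->
  e \in subdiv F color k.+1 a.2 -> size e.2 = k.+1 /\ join_simplex e.2.
Proof.
move=> kn ac /mem_subdiv_color[|y yt ->]; first exact: (resolution_size cP).
rewrite size_rev size_map size_iota; split=> //.
apply/join_simplex_rev/(P_join (g := 0) kn (resolution_in cP kn ac)) => j jk.
by rewrite (Zp_action_seq actP).1; exact: yt.
Qed.

(** The descent along the resolution, on cochains. By exactness [phi] is the image of some [psi]
    under the other group ring element, and the coboundary of [psi] is the next cochain; the formula
    for the boundary of [c k.+1] passes the value 1 on. *)
Lemma exists_detecting_cochain k : (k <= n)%N -> exists phi : seq V -> F,
  [/\ alternating phi, forall u, cobound phi u = 0,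
      forall u, size u = k.+1 -> join_simplex u -> group_ring_op shf (odd k) phi u
        = 0 &
      pairing (fun t => pairing phi (subdiv F color k.+1 t)) (c k) = 1].
Proof.
elim: k => [_|k IH kn].
  (* The coboundary of the indicator of the empty tuple is the augmentation, with value 1 on each
     vertex; its norm is [p], hence zero in [F]. *)
  exists (cobound (fun t => (size t == 0%N)%:R)); split.
  - apply: alternating_cobound; split=> [a x y b|a x b].
      by rewrite !size_cat /= !addnS /= oppr0.
    by rewrite !size_cat /= !addnS.
  - by move=> u; rewrite cobound_cobound.
  - move=> [//|v [|//]] _ _; rewrite /group_ring_op -[RHS](sumr_const_Zp pF p_gt1 1).
    by apply: eq_bigr => g _ /=; rewrite subr0.
  - rewrite (resolution0 cP) pairing_cons pairing_nil mul1r addr0.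
    by rewrite pairing_prefix !pairing_cons !pairing_nil /= !mul1r subr0 !addr0.
have kn' := ltnW kn; have [phi [altphi cphi opphi <-]] := IH kn'.
have [psi altpsi psiE] := group_ring_op_exact p_prime altphi opphi.
exists (cobound psi); split.
- exact: alternating_cobound.
- by move=> u; rewrite cobound_cobound.
- move=> u su pu; rewrite -group_ring_op_cobound -[RHS](cphi u).
  apply: eq_in_cobound => w wu; rewrite su => -[sw]; rewrite /= psiE //.
  by apply: join_simplex_sub pu; exact: mem_subseq.
- have {1}-> : pairing (fun t =>
    pairing (cobound psi) (subdiv F color k.+2 t)) (c k.+1)
     = pairing (cobound (fun t => pairing psi (subdiv F color k.+1 t))) (c k.+1).
    apply: eq_in_pairing => a ac; rewrite pairing_cobound_subdiv //.
    exact: (resolution_size cP kn ac).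
  rewrite (resolution_bound cP) //; apply: eq_in_pairing => a ac.
  have sa := resolution_size cP kn' ac.
  rewrite pairing_op_subdiv //;
    apply: eq_in_pairing => e /(mem_subdiv_join kn' ac)[se pe].
  by rewrite /= psiE.
Qed.

(** The boundary is the norm times [s - 1] or times the norm, applied to [c n.-1], and both products
    vanish. For [n = 0] it is [p] times the empty tuple. *)
Lemma resolution_norm_cycle (h : seq X -> F) :
  pairing (cobound (op false h)) (c n) = 0.
Proof.
have [n0|n_gt0] := posnP n.
  rewrite n0 (resolution0 cP) pairing_cons pairing_nil /= mul1r subr0 addr0.
  exact: sumr_const_Zp.
have := @resolution_bound _ _ _ _ _ _ _ _ cP n.-1 (op false h).
rewrite prednK // leqnn => -> //; rewrite /pairing big1 // => a _.
case: odd; first by rewrite (norm_diff actP true) mulr0.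
by rewrite norm_norm ?mulr0.
Qed.

(* The chain [\sum_g g (c n)] is a cycle whose image in the join cannot be
   zero; as the join is a sphere of dimension [n], its image covers all facets. *)
Lemma exists_simplex_on_facet (s : 'I_d -> 'Z_p) :
  exists t g (y : nat -> X), [/\ P t,
    forall j, (j <= n)%N -> y j \in map (act g) t &
    facet s [seq label j (y j) | j <- iota 0 n.+1]].
Proof.
apply: contrapT => nofacet.
have [phi [altphi _ opphi phi1]] := exists_detecting_cochain (leqnn n).
have opphi1 u : size u = n.+1 -> join_simplex u -> group_ring_op shf true phi u = 0.
  (* For odd [p] the number [n + 1 = d (p - 1)] is even, so [n] is odd. For [p = 2] the norm [1 + s]
     equals [s - 1] modulo 2. *)
  move=> su pu; case: (boolP (odd n)) opphi => [_|on] opphi; first exact: opphi.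
  have p2 : p = 2.
    case: (even_prime p_prime) => // op.
    have : odd (d * (p - 1)) = false by rewrite oddM oddB ?prime_gt0 // op andbF.
    by rewrite -nE /= on.
  have := opphi u su pu; rewrite /group_ring_op (sum_Zp2 _ p2).
  rewrite (Zp_action_seq (Zp_action_shift _ _)).1 => /eqP.
  rewrite addrC addr_eq0 => /eqP ->.
  have F2 : 1 *+ 2 = 0 :> F by have := pF; rewrite p2.
  by rewrite -opprD -mulr2n -mulr_natr F2 mulr0 oppr0.
have [psi altpsi psiE] := group_ring_op_exact p_prime altphi opphi1.
pose C := extend (subdiv F color n.+1) (group_ring_chain act false (c n)).
have memC a : a \in C -> exists b g y, [/\ P b,
    forall j, (j <= n)%N -> y j \in map (act g) b &
    a.2 = rev [seq label j (y j) | j <- iota 0 n.+1]].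
  move=> /mem_extend[b' /(mem_group_ring_chain actP)[g [b bc eb]] [e eC ->]].
  have sb := resolution_size cP (leqnn n) bc.
  have [|y yb ->] := mem_subdiv_color _ eC; first by rewrite eb size_map.
  by exists b.2, g, y; split=> //;
    [exact: (resolution_in cP (leqnn n) bc)|rewrite -eb].
have pairC f : pairing f C =
    pairing (op false (fun t => pairing f (subdiv F color n.+1 t))) (c n).
  by rewrite pairing_extend pairing_group_ring_chain.
(* The norm moves from the chain to [psi], where it gives [phi]. *)
have : pairing psi C = 1.
  rewrite pairC -phi1; apply: eq_in_pairing => a ac.
  have sa := resolution_size cP (leqnn n) ac.
  rewrite pairing_op_subdiv //;
    apply: eq_in_pairing => e /(mem_subdiv_join (leqnn n) ac)[se pe].
  by rewrite -psiE.
rewrite (cycle_avoiding_facet_eq0 p_prime (s := s)) //.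
- by move/esym/eqP; rewrite oner_eq0.
- move=> a /memC[b [g [y [Pb yb ->]]]].
  split; first by rewrite size_rev size_map size_iota nE.
  by apply: join_simplex_rev; exact: P_join Pb yb.
- move=> f; rewrite pairC -[RHS](resolution_norm_cycle (fun t =>
    pairing f (subdiv F color n t))).
  apply: eq_in_pairing => a ac; have sa := resolution_size cP (leqnn n) ac.
  rewrite group_ring_op_cobound; apply: eq_bigr => g _.
  by rewrite pairing_cobound_subdiv // size_map.
- move=> a /memC[b [g [y [Pb yb ->]]]]; apply/negP => /facetP fs.
  apply: nofacet; exists b, g, y; split=> //.
  by apply/facetP => v; rewrite -fs mem_rev.
Qed.

End ColorfulDegree.

(** * Barycentric subdivision in Euclidean space *)

Section Geometry.
Variables (R : realType) (n : nat).
Local Notation E := 'rV[R]_n.+1.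
Local Notation N := (n.+1%:R : R).
Implicit Types (x y z : E) (t u : seq E) (r : R).

Definition dot x y : R := \sum_i x ord0 i * y ord0 i.

Definition close r x y : Prop := forall i, `|x ord0 i - y ord0 i| <= r.

Definition small r t : Prop := forall x y, x \in t -> y \in t -> close r x y.

Definition barycenter t : E := (size t)%:R^-1 *: \sum_(x <- t) x.

Definition average_closed (C : E -> Prop) : Prop :=
  forall t, t != [::] -> (forall x, x \in t -> C x) -> C (barycenter t).

(* Not the full convex hull, but closed under all iterated barycentric
   subdivisions and contained in every convex set that contains [t]. *)
Definition hull t x : Prop := forall C, average_closed C ->
  (forall y, y \in t -> C y) -> C x.

Lemma average_closed_hull t : average_closed (hull t).
Proof. by move=> u u0 uh C avC tC; apply: (avC) => // x xu; exact: (uh x xu). Qed.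

Lemma hull_vertex t x : x \in t -> hull t x.
Proof. by move=> xt C _; exact. Qed.

Lemma hull_trans t u x : (forall y, y \in u -> hull t y) -> hull u x -> hull t x.
Proof. by move=> ut; apply => //; exact: average_closed_hull. Qed.

Lemma hull_sub t u x : {subset u <= t} -> hull u x -> hull t x.
Proof. by move=> ut; apply: hull_trans => y /ut; exact: hull_vertex. Qed.

Lemma dot_barycenter v t :
  dot v (barycenter t) = (size t)%:R^-1 * \sum_(x <- t) dot v x.
Proof.
rewrite /dot exchange_big /= mulr_sumr; apply: eq_bigr => i _.
by rewrite mxE summxE mulrCA -mulr_sumr.
Qed.

Lemma average_closed_ge v r : average_closed (fun x => r <= dot v x).
Proof.
move=> t t0 tr; rewrite dot_barycenter.
have st : 0 < (size t)%:R :> R by rewrite ltr0n lt0n size_eq0.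
rewrite ler_pdivlMl //.
have -> : (size t)%:R * r = \sum_(x <- t) r.
  by rewrite big_const_seq count_predT iter_addr_0 mulr_natl.
rewrite !big_seq; apply: ler_sum => x; exact: tr.
Qed.

Lemma dotC x y : dot x y = dot y x.
Proof. by apply: eq_bigr => i _; rewrite mulrC. Qed.

Lemma dotDr x y z : dot x (y + z) = dot x y + dot x z.
Proof. by rewrite /dot -big_split; apply: eq_bigr => i _; rewrite mxE mulrDr. Qed.

Lemma dotZr x r y : dot x (r *: y) = r * dot x y.
Proof. by rewrite /dot mulr_sumr; apply: eq_bigr => i _; rewrite mxE mulrCA. Qed.

Lemma dotNr x y : dot x (- y) = - dot x y.
Proof. by rewrite -scaleN1r dotZr mulN1r. Qed.

Lemma dotNl x y : dot (- x) y = - dot x y.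
Proof. by rewrite dotC dotNr dotC. Qed.

Lemma dot_delta i x : dot (delta_mx ord0 i) x = x ord0 i.
Proof.
rewrite /dot (bigD1 i) //= big1 => [|j ji]; first by rewrite mxE !eqxx mul1r addr0.
by rewrite mxE (negPf ji) andbF mul0r.
Qed.

Lemma average_closed_close r x : average_closed (close r x).
Proof.
move=> t t0 tx i; rewrite ler_distlC -!(dot_delta i).
have lo : dot (delta_mx ord0 i) x - r <= dot (delta_mx ord0 i) (barycenter t).
  apply: (@average_closed_ge (delta_mx ord0 i) _ t t0) => y /tx/(_ i).
  by rewrite !dot_delta ler_distlC => /andP[].
have : - (dot (delta_mx ord0 i) x + r) <= dot (- delta_mx ord0 i) (barycenter t).
  apply: (@average_closed_ge (- delta_mx ord0 i) _ t t0) => y /tx/(_ i).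
  by rewrite dotNl lerN2 !dot_delta ler_distlC => /andP[].
by rewrite dotNl; move: lo; lra.
Qed.

Lemma close_sym r x y : close r x y -> close r y x.
Proof. by move=> xy i; rewrite distrC. Qed.

Lemma close_le r r' x y : r <= r' -> close r x y -> close r' x y.
Proof. by move=> rr xy i; exact: le_trans (xy i) rr. Qed.

Lemma small_le r r' t : r <= r' -> small r t -> small r' t.
Proof. by move=> rr st x y xt yt; exact: close_le (st _ _ xt yt). Qed.

Lemma hull_close r x t : (forall y, y \in t -> close r x y) ->
  forall y, hull t y -> close r x y.
Proof. by move=> xt y; apply => //; exact: average_closed_close. Qed.

Lemma hull_small r t u : small r t -> (forall x, x \in u -> hull t x) -> small r u.
Proof.
move=> st ut x y /ut tx /ut ty; apply: hull_close ty => {}y yt.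
by apply/close_sym; apply: hull_close tx => {}x xt; exact: st.
Qed.

(** The barycentre minus [y] is an average of [m + 1] differences, and the one that belongs to [y]
    itself is zero. *)
Lemma close_barycenter r m t y : size t = m.+1 -> small r t -> y \in t ->
  close (m%:R / m.+1%:R * r) (barycenter t) y.
Proof.
move=> sz st yt i.
have -> : barycenter t ord0 i - y ord0 i =
    m.+1%:R^-1 * \sum_(x <- t) (x ord0 i - y ord0 i).
  rewrite sumrB big_const_seq count_predT iter_addr_0 sz mulrBr -[y ord0 i *+
    _]mulr_natl mulKf ?pnatr_eq0 //.
  by rewrite mxE summxE sz.
rewrite normrM ger0_norm ?invr_ge0 ?ler0n // [_ / _]mulrC -mulrA.
rewrite ler_wpM2l ?invr_ge0 ?ler0n //.
rewrite (big_rem _ yt) /= subrr add0r (le_trans (ler_norm_sum _ _ _)) //.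
have -> : m%:R * r = \sum_(x <- rem y t) r.
  by rewrite big_const_seq count_predT iter_addr_0 mulr_natl size_rem ?sz.
rewrite !big_seq; apply: ler_sum => x /mem_rem xt.
exact: st.
Qed.

Lemma mem_subdiv_hull (F : comNzRingType) m t a : size t = m ->
  a \in subdiv F barycenter m t ->
  size a.2 = m /\ forall x, x \in a.2 -> hull t x.
Proof.
elim: m t a => [|m IH] t a st; first by rewrite inE => /eqP ->.
rewrite subdivS => /mem_prefix[b /mem_extend[e et [e' e'e be']] ->].
have [sub] := mem_bound et; rewrite st => -[se].
have [sb hb] := IH _ _ se e'e; rewrite be' /= sb; split=> // x.
rewrite inE => /orP[/eqP ->|/hb].
  by apply: average_closed_hull => [|y]; [rewrite -size_eq0 st|exact: hull_vertex].
by apply: hull_sub; exact: mem_subseq.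
Qed.

(** Of two entries, either one is the barycentre of [t], which is close enough to the whole hull, or
    both belong to the subdivision of a face, where induction gives the smaller factor of lower
    dimension. *)
Lemma mem_subdiv_small (F : comNzRingType) m t a r : size t = m.+1 -> 0 <= r ->
  small r t -> a \in subdiv F barycenter m.+1 t -> small (m%:R / m.+1%:R * r) a.2.
Proof.
elim: m t a => [|m IH] t a st r0 rt.
  move=> /mem_subdiv_hull[//|]; case: a => k [|x [|]] //= _ _ y z.
  rewrite !inE => /eqP -> /eqP -> i.
  by rewrite subrr normr0 !mul0r.
rewrite subdivS => /mem_prefix[b /mem_extend[e et [e' e'e be']] ->].
have [sub] := mem_bound et; rewrite st => -[se].
have eqt := mem_subseq sub.
have cb : forall y, y \in b.2 -> close (m.+1%:R / m.+2%:R * r) (barycenter t) y.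
  move=> y yb; apply: (hull_close (t := t)) => [z zt|]; first exact: close_barycenter.
  apply: (hull_sub eqt); have [_] := mem_subdiv_hull se e'e; apply.
  by rewrite -be'.
have sb : small (m.+1%:R / m.+2%:R * r) b.2.
  rewrite be'; apply: small_le (IH _ _ se r0 _ e'e).
    rewrite ler_wpM2r // ler_pdivrMr ?ltr0n // mulrAC ler_pdivlMr ?ltr0n //.
    by rewrite -!natrM ler_nat; lia.
  by move=> x y /eqt xt /eqt; exact: rt.
move=> x y; rewrite !inE => /orP[/eqP ->|xb] /orP[/eqP ->|yb].
- by move=> i; rewrite subrr normr0 mulr_ge0 // divr_ge0 ?ler0n.
- exact: cb.
- exact/close_sym/cb.
- exact: sb.
Qed.

Lemma mem_subdiv_htpy (F : comNzRingType) m t a : size t = m ->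
  a \in subdiv_htpy F barycenter m t ->
  size a.2 = m.+1 /\ forall x, x \in a.2 -> hull t x.
Proof.
elim: m t a => [|m IH] t a st //.
rewrite subdiv_htpyS => /mem_prefix[b]; rewrite inE => bP ->.
have [sb hb] : size b.2 = m.+1 /\ forall x, x \in b.2 -> hull t x.
  case/orP: bP => [/eqP ->|]; first by split=> // x; exact: hull_vertex.
  move=> /mem_scale[_ /mem_extend[e et [e' e'e ->]] ->].
  have [sub] := mem_bound et; rewrite st => -[se].
  have [-> hb] := IH _ _ se e'e; split=> // x /hb.
  by apply: hull_sub; exact: mem_subseq.
rewrite /= sb; split=> // x; rewrite inE => /orP[/eqP ->|/hb//].
by apply: average_closed_hull => [|y]; [rewrite -size_eq0 st|exact: hull_vertex].
Qed.

End Geometry.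

(** * Euclidean norm and radial projection to the sphere *)

Section Normalization.
Variables (R : realType) (n : nat).
Local Notation E := 'rV[R]_n.+1.
Implicit Types (x y z : E) (t u : seq E) (r : R).

Definition enorm x : R := Num.sqrt (dot x x).

Definition normalize x : E := (enorm x)^-1 *: x.

Lemma dot_ge0 x : 0 <= dot x x.
Proof. by apply: sumr_ge0 => i _; rewrite -expr2 sqr_ge0. Qed.

Lemma enorm_sqr x : enorm x ^+ 2 = dot x x.
Proof. by rewrite sqr_sqrtr // dot_ge0. Qed.

Lemma coord_le_enorm x i : `|x ord0 i| <= enorm x.
Proof.
rewrite -sqrtr_sqr ler_wsqrtr // /dot (bigD1 i) //= expr2 lerDl.
by apply: sumr_ge0 => j _; rewrite -expr2 sqr_ge0.
Qed.

Lemma dot_normalize x : 0 < enorm x -> dot (normalize x) (normalize x) = 1.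
Proof.
move=> x0; rewrite /normalize dotZr dotC dotZr -enorm_sqr.
by rewrite expr2 mulKf ?mulVf ?gt_eqF.
Qed.

Lemma normalize_id x : dot x x = 1 -> normalize x = x.
Proof. by move=> x1; rewrite /normalize /enorm x1 sqrtr1 invr1 scale1r. Qed.

(** A linear functional bounded below keeps [x] away from the origin; the added 1 keeps the
    denominator positive. *)
Lemma enorm_ge v x r : 0 < r -> r <= dot v x ->
  r / (1 + \sum_i `|v ord0 i|) <= enorm x.
Proof.
move=> r0 rv; have s0 : 0 <= \sum_i `|v ord0 i| by apply: sumr_ge0.
rewrite ler_pdivrMr ?ltr_wpDr // mulrDr mulr1 ler_wpDl ?sqrtr_ge0 //.
apply: le_trans rv _; apply: le_trans (ler_norm _) _.
apply: le_trans (ler_norm_sum _ _ _) _; rewrite mulr_sumr; apply: ler_sum => i _.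
by rewrite normrM mulrC ler_wpM2r // coord_le_enorm.
Qed.

Lemma dist_enorm r x y : 0 < enorm x -> close r x y ->
  `|enorm y - enorm x| <= n.+1%:R * r.
Proof.
move=> x0 xy.
have y0 : 0 <= enorm y by exact: sqrtr_ge0.
have s0 : 0 < enorm y + enorm x by rewrite ltr_wpDl.
rewrite -(ler_pM2r s0) -{1}(gtr0_norm s0) -normrM -subr_sqr !enorm_sqr.
rewrite /dot -sumrB; apply: le_trans (ler_norm_sum _ _ _) _.
have -> : n.+1%:R * r * (enorm y + enorm x) = \sum_(i < n.+1) r * (enorm y + enorm x).
  by rewrite sumr_const card_ord -[RHS]mulr_natl mulrA.
apply: ler_sum => i _.
rewrite -!expr2 subr_sqr normrM ler_pM //; first by rewrite distrC.
by apply: le_trans (ler_normD _ _) _; rewrite lerD ?coord_le_enorm.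
Qed.

(** Up to division by [enorm x], the difference splits into [x - y], bounded by [r], and the change
    of the norm, bounded by [n + 1] times [r]. *)
Lemma close_normalize r k x y : 0 < k -> k <= enorm x -> 0 < enorm y ->
  close r x y -> close ((n.+2)%:R * r / k) (normalize x) (normalize y).
Proof.
move=> k0 kx y0 xy i; have x0 : 0 < enorm x by exact: lt_le_trans kx.
have r0 : 0 <= r by apply: le_trans (xy i).
rewrite !mxE.
have -> : (enorm x)^-1 * x ord0 i - (enorm y)^-1 * y ord0 i =
  (x ord0 i - y ord0 i + y ord0 i / enorm y * (enorm y - enorm x)) / enorm x.
  by field; rewrite !gt_eqF.
rewrite normrM normfV (gtr0_norm x0) ler_pM ?invr_ge0 ?(ltW x0) //;
  last by rewrite lef_pV2 ?posrE.
apply: le_trans (ler_normD _ _) _; rewrite -[n.+2%:R]/(1 *+ n.+2) mulrS mulrDl mul1r.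
rewrite lerD // normrM -[leRHS]mul1r ler_pM //; last exact: dist_enorm.
by rewrite normrM normfV (gtr0_norm y0) ler_pdivrMr // mul1r coord_le_enorm.
Qed.

End Normalization.

(** * Orthogonal vectors and vectors in general position *)

Section Generic.
Variables (R : realType) (n : nat).
Local Notation E := 'rV[R]_n.+1.

Lemma exists_orthogonal (t : seq E) : (size t <= n)%N ->
  exists2 u : E, u != 0 & forall x, x \in t -> dot u x = 0.
Proof.
move=> tn; pose M : 'M[R]_(n.+1, size t) := \matrix_(i, j) (nth 0 t j) ord0 i.
have /rowV0Pn[u /sub_kermxP uM u0] : kermx M != 0.
  rewrite -mxrank_eq0 mxrank_ker subn_eq0 -ltnNge ltnS.
  exact: leq_trans (rank_leq_col _) tn.
exists u => // x xt; have xi : (index x t < size t)%N by rewrite index_mem.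
have /matrixP/(_ ord0 (Ordinal xi)) := uM; rewrite !mxE => <-.
by apply: eq_bigr => i _; rewrite mxE nth_index.
Qed.

(* Each condition excludes finitely many points of the moment curve. *)
Lemma exists_generic (us : seq E) : (forall u, u \in us -> u != 0) ->
  exists w : E, forall u, u \in us -> dot u w != 0.
Proof.
move=> us0; pose q (u : E) : {poly R} := \poly_(i < n.+1) u ord0 (inord i).
pose Q := \prod_(u <- us) q u.
have Q0 : Q != 0.
  rewrite prodf_seq_neq0; apply/allP => u /us0 /=; apply: contraNneq.
  move=> /polyP qu; apply/eqP/rowP => i; have := qu i.
  by rewrite coef_poly ltn_ord inord_val coef0 mxE.
have [s Qs] : exists s, ~~ root Q s.
  apply: contrapT => H; pose rs := [seq k%:R : R | k <- iota 0 (size Q)].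
  have : (size rs < size Q)%N.
    apply: max_poly_roots => //; last first.
      by rewrite map_inj_uniq ?iota_uniq // => a b /eqP; rewrite eqr_nat => /eqP.
    by apply/allP => s _; apply: contrapT => /negP sQ; apply: H; exists s.
  by rewrite size_map size_iota ltnn.
exists (\row_i s ^+ i) => u uus; apply: contra Qs => /eqP us1.
rewrite /root /Q (big_rem u) //= hornerM mulf_eq0 /q horner_poly; apply/orP; left.
apply/eqP; rewrite -[RHS]us1; apply: eq_bigr => i _.
by rewrite !mxE inord_val.
Qed.

End Generic.

(** * Vietoris cycles of the sphere *)

Section Acyclicity.
Variables (F : comNzRingType) (R : realType) (n : nat).
Local Notation E := 'rV[R]_n.+1.
Local Notation bary := (@barycenter R n).
Implicit Types (t u : seq E) (c z : chain F E).

Definition iter_subdiv (m k : nat) z : chain F E :=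
  iter k (extend (subdiv F bary m)) z.

Lemma mem_iter_subdiv m k z a : (forall b, b \in z -> size b.2 = m) ->
  a \in iter_subdiv m k z ->
  size a.2 = m /\ exists2 b, b \in z & forall x, x \in a.2 -> hull b.2 x.
Proof.
move=> zm; elim: k a => [|k IH] a.
  by move=> az; split; [exact: zm|exists a => // x; exact: hull_vertex].
rewrite /iter_subdiv iterS => /mem_extend[b /IH[sb [e ez be]] [e' e'b ->]].
have [se' he'] := mem_subdiv_hull sb e'b.
by split=> //; exists e => // x /he'; exact: hull_trans.
Qed.

Lemma mem_iter_subdiv_small m k z a r : 0 <= r ->
  (forall b, b \in z -> size b.2 = m.+1) -> (forall b, b \in z -> small r b.2) ->
  a \in iter_subdiv m.+1 k z -> small ((m%:R / m.+1%:R) ^+ k * r) a.2.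
Proof.
move=> r0 zm zr; elim: k a => [|k IH] a.
  by rewrite expr0 mul1r; exact: zr.
rewrite /iter_subdiv iterS => /mem_extend[b bk [e' e'b ->]].
have [sb _] := mem_iter_subdiv zm bk.
rewrite exprS -mulrA; apply: mem_subdiv_small e'b => //; last exact: IH.
by rewrite mulr_ge0 // exprn_ge0 // divr_ge0 ?ler0n.
Qed.

Lemma pairing_iter_subdivS m k z f : pairing f (iter_subdiv m k.+1 z) =
  pairing (fun t => pairing f (subdiv F bary m t)) (iter_subdiv m k z).
Proof. by rewrite /iter_subdiv iterS pairing_extend. Qed.

Lemma iter_subdiv_bound m k y z :
  (forall a, a \in y -> size a.2 = m.+1) ->
  (forall f, pairing (cobound f) y = pairing f z) ->
  forall f, pairing (cobound f) (iter_subdiv m.+1 k y)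
    = pairing f (iter_subdiv m k z).
Proof.
move=> ym yz; elim: k => [|k IH] f; first exact: yz.
rewrite !pairing_iter_subdivS -IH; apply: eq_in_pairing => a ak.
have [sa _] := mem_iter_subdiv ym ak.
by rewrite pairing_cobound_subdiv.
Qed.

Lemma iter_subdiv_cycle m k z : (forall a, a \in z -> size a.2 = m.+1) ->
  (forall f, pairing (cobound f) z = 0) ->
  forall f, pairing (cobound f) (iter_subdiv m.+1 k z) = 0.
Proof.
move=> zm z0 f; rewrite (@iter_subdiv_bound m k z [::]) //; last first.
  by move=> g; rewrite z0 pairing_nil.
by rewrite (_ : iter_subdiv m k [::] = [::]) ?pairing_nil //; elim: k => //= k ->.
Qed.

(** The homotopies of the successive subdivisions telescope; on a cycle the term with the homotopy
    of the boundary drops out. *)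
Lemma iter_subdiv_homologous m k z : (forall a, a \in z -> size a.2 = m.+1) ->
  (forall f, pairing (cobound f) z = 0) ->
  exists2 h : chain F E,
    forall a, a \in h ->
      size a.2 = m.+2 /\ exists2 b, b \in z & forall x, x \in a.2 -> hull b.2 x &
    forall f, pairing (cobound f) h = pairing f z - pairing f (iter_subdiv m.+1 k z).
Proof.
move=> zm z0; elim: k => [|k [h hP hE]].
  by exists [::] => // f; rewrite pairing_nil subrr.
exists (h ++ extend (subdiv_htpy F bary m.+1) (iter_subdiv m.+1 k z)).
  move=> a; rewrite mem_cat => /orP[/hP//|/mem_extend[b bk [e eb ->]]].
  have [sb [b' b'z hb]] := mem_iter_subdiv zm bk.
  have [-> he] := mem_subdiv_htpy sb eb; split=> //; exists b' => // x /he.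
  exact: hull_trans.
move=> f; rewrite pairing_cat hE pairing_extend.
have htpy_cycle := iter_subdiv_cycle k zm z0
  (fun u => pairing f (subdiv_htpy F bary m u)).
have -> : pairing (fun t => pairing (cobound f) (subdiv_htpy F bary m.+1 t))
    (iter_subdiv m.+1 k z) = pairing f (iter_subdiv m.+1 k z) -
    pairing (fun t => pairing f (subdiv F bary m.+1 t)) (iter_subdiv m.+1 k z).
  rewrite -pairingB -[LHS]addr0 -{}htpy_cycle -pairingD.
  apply: eq_in_pairing => a ak; have [sa _] := mem_iter_subdiv zm ak.
  by rewrite pairing_cobound_htpy.
by rewrite pairing_iter_subdivS; ring.
Qed.

Lemma exists_uniform (T : eqType) (l : seq T) (Q : T -> R -> Prop) :
  (forall a r r', r' <= r -> 0 < r' -> Q a r -> Q a r') ->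
  (forall a, a \in l -> exists2 r, 0 < r & Q a r) ->
  exists2 r, 0 < r & forall a, a \in l -> Q a r.
Proof.
move=> Qle; elim: l => [|a l IH] lP; first by exists 1.
have [|r r0 lr] := IH; first by move=> b bl; apply: lP; rewrite inE bl orbT.
have [r' r'0 ar'] := lP a (mem_head _ _).
have m0 : 0 < Order.min r r' by rewrite lt_min r0.
exists (Order.min r r') => // b; rewrite inE => /orP[/eqP ->|/lr].
  by apply: Qle ar' => //; rewrite ge_min lexx orbT.
by apply: Qle => //; rewrite ge_min lexx.
Qed.

(** The bound is [r^-1], so that the condition weakens as [r] decreases, which is the form that
    [exists_uniform] takes. *)
Lemma exists_small t : exists2 r, 0 < r & small r^-1 t.
Proof.
have [|x xt|r r0 tr] := @exists_uniform _ t (fun x r => forall i,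
  `|x ord0 i| <= r^-1).
- by move=> x r r' rr' r'0 xr i; apply: le_trans (xr i) _;
    rewrite lef_pV2 ?posrE // (lt_le_trans r'0).
- have s0 : 0 <= \sum_i `|x ord0 i| by apply: sumr_ge0.
  exists (1 + \sum_i `|x ord0 i|)^-1; first by rewrite invr_gt0 ltr_wpDr.
  move=> i; rewrite invrK (bigD1 i) //= addrCA lerDl addr_ge0 //.
  by apply: sumr_ge0.
exists (r / 2); first by rewrite divr_gt0.
move=> x y /tr xr /tr yr i; rewrite invf_div.
by apply: le_trans (ler_normB _ _) _; have := xr i; have := yr i; lra.
Qed.

Lemma exists_expr_le (q a e : R) : 0 <= q -> q < 1 -> 0 <= a -> 0 < e ->
  exists k, q ^+ k * a <= e.
Proof.
move=> q0 q1 a0 e0; have h0 : 0 < 1 - q by rewrite subr_gt0.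
have bern k : q ^+ k * (1 + k%:R * (1 - q)) <= 1.
  elim: k => [|k IH]; first by rewrite mul0r addr0 mulr1.
  apply: le_trans IH; rewrite exprSr -mulrA ler_wpM2l ?exprn_ge0 //.
  have k0 : 0 <= k%:R :> R by exact: ler0n.
  rewrite -natr1; have := mulr_ge0 k0 (sqr_ge0 (1 - q)); have := sqr_ge0 (1 - q); nra.
have b0 : 0 <= a / ((1 - q) * e) by rewrite divr_ge0 ?mulr_ge0 ?(ltW h0) ?(ltW e0).
have := archi_boundP b0; set k := Num.bound _ => kP; exists k.
have ak : a <= e * (1 + k%:R * (1 - q)).
  move: kP; rewrite ltr_pdivrMr ?mulr_gt0 // => kP; nra.
apply: le_trans (_ : q ^+ k * (e * (1 + k%:R * (1 - q))) <= e).
  by rewrite ler_wpM2l ?exprn_ge0.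
by rewrite mulrCA -[leRHS]mulr1 ler_pM2l.
Qed.

(** The bound of [enorm_ge] for the value [1 / 2] and a unit vector, whose [n + 1] coordinates have
    modulus at most 1. *)
Let kappa0 : R := 1 / 2 / (1 + n.+1%:R).

Lemma dot_unit_ge (r : R) (x y : E) : dot x x = 1 -> r * n.+1%:R <= 1 / 2 ->
  close r x y -> 1 / 2 <= dot x y.
Proof.
move=> x1 rn xy; have r0 : 0 <= r by apply: le_trans (xy ord0).
have -> : dot x y = 1 - dot x (x - y) by rewrite dotDr dotNr x1; ring.
have : dot x (x - y) <= n.+1%:R * r.
  apply: le_trans (ler_norm _) _; apply: le_trans (ler_norm_sum _ _ _) _.
  rewrite -[leRHS]mulr1.
  have -> : n.+1%:R * r * 1
    = \sum_(i < n.+1) r by rewrite mulr1 sumr_const card_ord mulr_natl.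
  apply: ler_sum => i _; rewrite normrM -[leRHS]mul1r ler_pM //.
    by apply: le_trans (coord_le_enorm _ _) _; rewrite /enorm x1 sqrtr1.
  by rewrite !mxE.
by move: rn; rewrite mulrC; lra.
Qed.

Lemma enorm_hull_ge (r : R) t (x0 x : E) : x0 \in t -> r * n.+1%:R <= 1 / 2 ->
  (forall y, y \in t -> dot y y = 1) -> small r t -> hull t x -> kappa0 <= enorm x.
Proof.
move=> x0t rn t1 tr tx.
have h : 1 / 2 <= dot x0 x.
  by apply: (tx (fun y : E => 1 / 2 <= dot x0 y));
    [exact: average_closed_ge|move=> y yt; apply: dot_unit_ge rn _;
      [exact: t1|exact: tr]].
apply: le_trans (enorm_ge _ h); last by lra.
have x01 i : `|x0 ord0 i| <= 1.
  by apply: le_trans (coord_le_enorm _ _) _; rewrite /enorm t1 ?sqrtr1.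
have s0 : 0 <= \sum_i `|x0 ord0 i| by apply: sumr_ge0.
have sN : \sum_i `|x0 ord0 i| <= n.+1%:R.
  have -> : n.+1%:R = \sum_(i < n.+1) (1 : R) by rewrite sumr_const card_ord.
  exact: ler_sum.
rewrite /kappa0 ler_wpM2l ?lef_pV2 ?posrE ?lerD2l ?ltr_wpDr ?ler0n //; lra.
Qed.

Lemma exists_cone_enorm_ge (r : R) t (w v0 : E) : (0 < size t)%N ->
  r * n.+1%:R <= 1 / 2 -> (forall y, y \in t -> dot y y = 1) -> small r t ->
  (forall y, y \in t -> dot v0 y = 0) -> dot v0 w != 0 ->
  exists2 k, 0 < k & forall x, hull (- w :: t) x -> k <= enorm x.
Proof.
case: t => // x0 t _ rn t1 tr ut uw.
have x0s : x0 \in x0 :: t := mem_head _ _.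
(* The multiple of [v0] is chosen so that [v] has product [1 / 2] with the apex [- w]; with the
   points of [t] it has the same products as [x0]. *)
pose v := x0 - ((1 / 2 + dot x0 w) / dot v0 w) *: v0.
have vE y : dot v y = dot x0 y - (1 / 2 + dot x0 w) / dot v0 w * dot v0 y.
  by rewrite dotC dotDr dotNr dotZr !(dotC y).
have s0 : 0 < 1 + \sum_i `|v ord0 i| by rewrite ltr_wpDr // sumr_ge0.
exists (1 / 2 / (1 + \sum_i `|v ord0 i|)); first by rewrite divr_gt0 //; lra.
move=> x xs; apply: enorm_ge; first by lra.
apply: (xs (fun y : E => 1 / 2 <= dot v y)) => [|y]; first exact: average_closed_ge.
rewrite in_cons => /orP[/eqP ->|ys].
  by rewrite vE !dotNr mulrN divfK //; lra.
rewrite vE (ut y) // mulr0 subr0; apply: dot_unit_ge rn _; [exact: t1|exact: tr].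
Qed.

(* Cone the cycle from a generic vector [- w], whose hulls with the simplices
   avoid the origin, subdivide the cone in the ambient space until it is fine,
   and project back to the sphere. *)
Lemma sphere_acyclic (e : R) : 0 < e -> exists2 r, 0 < r &
  forall m z, (m < n)%N ->
    (forall a, a \in z -> [/\ size a.2 = m.+1, small r a.2 &
                             forall x, x \in a.2 -> dot x x = 1]) ->
    (forall f, pairing (cobound f) z = 0) ->
  exists2 y : chain F E,
    forall a, a \in y -> [/\ size a.2 = m.+2, small e a.2 &
                             forall x, x \in a.2 -> dot x x = 1] &
    forall f, pairing (cobound f) y = pairing f z.
Proof.
move=> e0; have N0 : 0 < n.+1%:R :> R by rewrite ltr0n.
have k0 : 0 < kappa0 by rewrite /kappa0 !divr_gt0 // ltr_wpDr.
(* The first bound keeps the hulls of the simplices of [z] at distance [kappa0] from the origin; the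
   second makes their projections [e]-small without subdivision. *)
pose r := Order.min (1 / 2 / n.+1%:R) (e * kappa0 / n.+2%:R).
have h0 : 0 < 1 / 2 :> R by rewrite divr_gt0.
have ek0 : 0 < e * kappa0 := mulr_gt0 e0 k0.
have r0 : 0 < r by rewrite lt_min (divr_gt0 h0 N0) divr_gt0.
have rn : r * n.+1%:R <= 1 / 2 by rewrite -ler_pdivlMr // ge_min lexx.
have re : n.+2%:R * r / kappa0 <= e.
  by rewrite ler_pdivrMr // mulrC -ler_pdivlMr ?ltr0n // ge_min lexx orbT.
exists r => // m z mn zP z0.
have zm a : a \in z -> size a.2 = m.+1 by case/zP.
(* As [m < n], each simplex of [z] has at most [n] vertices and hence a nonzero orthogonal vector; a
   generic [w] is orthogonal to none of these. *)
have [w wP] : exists w : E, forall a, a \in z ->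
    exists2 u : E, dot u w != 0 & forall x, x \in a.2 -> dot u x = 0.
  have /choice[u uP] : forall a : F * seq E, exists u : E, a \in z ->
      u != 0 /\ forall x, x \in a.2 -> dot u x = 0.
    move=> a; case: (boolP (a \in z)) => az; last by exists 0.
    by have [|u u0 ua] := @exists_orthogonal R n a.2; [rewrite zm|exists u].
  have [|w wP] := @exists_generic R n [seq u a | a <- z].
    by move=> _ /mapP[a az ->]; have [] := uP a az.
  exists w => a az; exists (u a); first by apply: wP; exact: map_f.
  by have [] := uP a az.
pose y0 := prefix_chain (- w) z.
have y0m a : a \in y0 -> size a.2 = m.+2 by move=> /mem_prefix[b /zm sb ->];
  rewrite /= sb.
have y0E f : pairing (cobound f) y0 = pairing f z.
  by rewrite pairing_prefix /= pairingB z0 subr0.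
have [k kpos kP] : exists2 k, 0 < k & forall a, a \in y0 ->
    forall x, hull a.2 x -> k <= enorm x.
  apply: exists_uniform => [a s s' ss _ as' x /as'|a /mem_prefix[b bz ->]].
    exact: le_trans.
  have [sb rb b1] := zP b bz; have [u uw ub] := wP b bz.
  by apply: (exists_cone_enorm_ge _ rn b1 rb ub uw); rewrite sb.
have [D D0 DP] : exists2 D, 0 < D & forall a, a \in y0 -> small D^-1 a.2.
  apply: exists_uniform => [a s s' ss s'0|a _]; last exact: exists_small.
  by apply: small_le; rewrite lef_pV2 ?posrE // (lt_le_trans s'0).
have q0 : 0 <= m.+1%:R / m.+2%:R :> R by rewrite divr_ge0.
(* The bound [k] on the cone depends on [z], and so does the number [j] of subdivisions, whereas [r]
   was fixed before [z]. *)
have [j jP] : exists j, (m.+1%:R / m.+2%:R) ^+ j * D^-1 <= e * k / n.+2%:R.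
  apply: exists_expr_le => //; last by rewrite !divr_gt0 ?mulr_gt0.
  - by rewrite ltr_pdivrMr // mul1r ltr_nat.
  - by rewrite invr_ge0 ltW.
have [h hP hE] := iter_subdiv_homologous j zm z0.
have norm_small s kk t : 0 < kk -> n.+2%:R * s / kk <= e -> small s t ->
    (forall x, x \in t -> kk <= enorm x) -> small e (map (@normalize R n) t).
  move=> kk0 se st tk _ _ /mapP[x xt ->] /mapP[y yt ->].
  apply: close_le se _; apply: close_normalize => //; first exact: tk.
    exact: lt_le_trans (tk _ yt).
  exact: st.
have norm_unit t kk : 0 < kk -> (forall x, x \in t -> kk <= enorm x) ->
    forall x, x \in map (@normalize R n) t -> dot x x = 1.
  move=> kk0 tk _ /mapP[x xt ->]; apply: dot_normalize.
  exact: lt_le_trans (tk _ xt).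
(* The subdivided cone bounds the subdivision of [z], and [h] connects the latter to [z], which the
   projection fixes. *)
exists (map_chain (@normalize R n) (iter_subdiv m.+2 j y0 ++ h)).
  move=> _ /mem_map_chain[a + ->]; rewrite mem_cat size_map => /orP[aY|ah].
    have [sa [b by0 hb]] := mem_iter_subdiv y0m aY.
    have ak x : x \in a.2 -> k <= enorm x by move=> /hb; exact: kP.
    split=> //; last exact: norm_unit ak.
    apply: norm_small ak => //; last first.
      by apply: (mem_iter_subdiv_small _ y0m DP aY); rewrite invr_ge0 ltW.
    by rewrite ler_pdivrMr // mulrC -ler_pdivlMr.
  have [sa [b bz hb]] := hP a ah; have [sb rb b1] := zP b bz.
  have ak x : x \in a.2 -> kappa0 <= enorm x.
    move=> /hb; case: b.2 sb rb b1 => // x0 t _ rb b1.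
    exact: (enorm_hull_ge (mem_head _ _) rn b1 rb).
  split=> //; last exact: norm_unit ak.
  apply: norm_small re _ ak => //.
  exact: hull_small hb.
move=> f; rewrite pairing_map -(eq_pairing _ (cobound_map f (@normalize R n))).
rewrite pairing_cat hE (iter_subdiv_bound j y0m y0E) addrC subrK.
apply: eq_in_pairing => a /zP[_ _ a1]; congr f.
by rewrite -[RHS]map_id; apply/eq_in_map => x /a1; exact: normalize_id.
Qed.

End Acyclicity.

Local Open Scope classical_set_scope.
Local Open Scope ring_scope.

(** * Compactness of the sphere *)

Section SphereTopology.
Variables (R : realType) (n : nat).
Local Notation E := 'rV[R]_n.+1.
Local Notation X := (sphere R n).
Implicit Types (x y : X) (r e : R).

Lemma dot_sphere x : dot (val x) (val x) = 1.
Proof.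
have := set_mem (valP x) => /= <-.
by apply: eq_bigr => i _; rewrite expr2.
Qed.

Lemma ball_close r x y : ball x r y -> close r (val x) (val y).
Proof. by move=> [_ xy] i; exact/ltW/xy. Qed.

Lemma close_ball r e x y : r < e -> close r (val x) (val y) -> ball x e y.
Proof.
move=> re xy; split=> [|i j]; first by apply: le_lt_trans re;
  apply: le_trans (xy ord0).
by rewrite ord1; exact: le_lt_trans (xy j) re.
Qed.

Lemma sphere_compact : compact (sphere R n).
Proof.
apply: bounded_closed_compact.
  exists 1; split=> // M M1 x Sx.
  apply: le_trans (ltW M1); rewrite /Num.norm /= mx_normrE; apply/bigmax_leP;
    split=> // -[i j] _.
  rewrite ord1 /=; apply: le_trans (coord_le_enorm _ _) _.
  have xx : dot x x = 1 by rewrite -[RHS]Sx; apply: eq_bigr => k _; rewrite expr2.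
  by rewrite /enorm xx sqrtr1.
have -> : sphere R n
  = (fun x : E => \sum_(i < n.+1) x ord0 i ^+ 2) @^-1` [set 1] by [].
apply: closed_comp; last exact: closed_eq.
move=> x _.
elim: (index_enum _) => [|i s IH].
  rewrite (_ : (fun _ => _) = fun=> 0 :> R); first exact: cst_continuous.
  by apply/funext => y; rewrite big_nil.
rewrite (_ : (fun _ => _)
  = fun y : E => y ord0 i ^+ 2 + \sum_(j <- s) y ord0 j ^+ 2); last first.
  by apply/funext => y; rewrite big_cons.
apply: continuousD IH;
  apply: (@continuous_comp _ _ _ (fun y : E => y ord0 i) (fun r : R => r ^+ 2)).
  exact: coord_continuous.
exact: exprn_continuous.
Qed.

(** The Lebesgue number argument in general form: compactness makes a locally valid radius
    uniform. *)
Lemma sphere_uniform (Q : R -> X -> Prop) :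
  (forall r r' x, r' <= r -> Q r x -> Q r' x) ->
  (forall x, exists2 r, 0 < r & forall y, close r (val x) (val y) -> Q r y) ->
  exists2 r, 0 < r & forall x, Q r x.
Proof.
move=> Qle Qloc.
have [nc _] := compact_near_coveringP (sphere R n).
have := nc sphere_compact R (0^'+) (fun r v => forall x, val x = v -> Q r x) _.
move=> [v Sv|d /= d0 dP].
  have [r r0 rQ] := Qloc (SigSub (mem_set Sv)).
  exists (ball v r, [set e | 0 < e < r]); first split=> /=.
  - exact: nbhsx_ballx.
  - near=> e; apply/andP; split; near: e; [exact: nbhs_right_gt|exact: nbhs_right_lt].
  move=> [w e] /= [[_ vw] /andP[e0 er]] x xw; apply: (Qle r); first exact: ltW.
  by move: vw; rewrite -{}xw => vw; apply: rQ => i; exact/ltW/vw.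
exists (d / 2); first by rewrite divr_gt0.
move=> x; apply: (dP (d / 2)) => //=.
- by rewrite sub0r normrN gtr0_norm ?divr_gt0 //; lra.
- by rewrite divr_gt0.
- exact: set_mem (valP x).
Unshelve. all: by end_near.
Qed.

Lemma sphere_uniformly_continuous (f : X -> X) e : continuous f -> 0 < e ->
  exists2 r, 0 < r & forall x y,
    close r (val x) (val y) -> close e (val (f x)) (val (f y)).
Proof.
move=> fc e0.
have [||r r0 rP] := @sphere_uniform
    (fun r x => forall y, close r (val x) (val y) -> close e (val (f x)) (val (f y))).
- by move=> r r' x rr xr y xy; apply: xr; exact: close_le xy.
- move=> x0; have e20 : 0 < e / 2 by rewrite divr_gt0.
  have /cvg_ballP/(_ _ e20)/nbhs_ballP[r /= r0 rP] := fc x0.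
  have r30 : 0 < r / 3 by rewrite divr_gt0.
  have near z : close (2 * (r / 3)) (val x0) (val z) ->
    close (e / 2) (val (f x0)) (val (f z)).
    by move=> xz; apply/ball_close/rP; apply: close_ball xz; lra.
  exists (r / 3) => // x x0x y xy i.
  have x0y : close (2 * (r / 3)) (val x0) (val y).
    by move=> j; have := ler_distD (val x ord0 j) (val x0 ord0 j) (val y ord0 j);
      have := x0x j; have := xy j; lra.
  have x0x' : close (2 * (r / 3)) (val x0) (val x) by apply: close_le x0x; lra.
  have := ler_distD (val (f x0) ord0 i) (val (f x) ord0 i) (val (f y) ord0 i).
  by have := near _ x0y i; have := near _ x0x' i; rewrite [in X in _ <= X + _]distrC;
    lra.
- by exists r.
Qed.

(** Every point has a neighbourhood that misses one of the [B j]; a uniform radius for these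
    neighbourhoods rules out close points [x j] of [B j]. *)
Lemma sphere_lebesgue (J : Type) (B : J -> set X) x0 :
  (forall j, closed (B j)) -> \bigcap_j B j = set0 ->
  exists2 r, 0 < r & forall x : J -> X, (forall j, B j (x j)) ->
    ~ (forall j k, close r (val (x j)) (val (x k))).
Proof.
move=> Bc B0.
have nB x : exists j, ~ B j x.
  apply: contrapT => H; have : set0 x by rewrite -B0 => j _; apply: contrapT => ?;
    apply: H; exists j.
  by [].
have [||r r0 rP] := @sphere_uniform
    (fun r x => exists j, forall y, close r (val x) (val y) -> ~ B j y).
- by move=> r r' x rr [j xj]; exists j => y xy; apply: xj; exact: close_le xy.
- move=> x; have [j Bjx] := nB x.
  have : nbhs x (~` B j) by apply: open_nbhs_nbhs; split=> //; exact: closed_openC.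
  move=> /nbhs_ballP[r /= r0 rP].
  exists (r / 3); first by rewrite divr_gt0.
  move=> y xy; exists j => z yz; apply: rP; apply: (@close_ball (2 * (r / 3)));
    first by lra.
  by move=> k; have := ler_distD (val y ord0 k) (val x ord0 k) (val z ord0 k);
      have := xy k; have := yz k; lra.
- exists r => // x Bx xr; have [j0 _] := nB x0; have [j jP] := rP (x j0).
  exact: (jP (x j)) (Bx j).
Qed.

End SphereTopology.

(** * Resolutions by small tuples *)

Section SphereResolution.
Variables (F : comNzRingType) (R : realType) (n p : nat).
Local Notation X := (sphere R n).
Variables (act : 'Z_p -> X -> X) (x0 : X).
Hypothesis actP : Zp_action act.
Hypothesis act_cont : forall g, continuous (act g).

(** The action need not be isometric, so smallness is imposed on all translates. *)
Definition orbit_small (e : R) (t : seq X) : Prop :=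
  forall g, small e (map val (map (act g) t)).

Lemma orbit_small_le e e' t : e <= e' -> orbit_small e t -> orbit_small e' t.
Proof. by move=> ee te g; exact: small_le (te g). Qed.

Lemma small_orbit_small e : 0 < e -> exists2 r, 0 < r &
  forall t : seq X, small r (map val t) -> orbit_small e t.
Proof.
move=> e0.
have [r r0 rP] : exists2 r, 0 < r & forall g, g \in enum 'Z_p ->
    forall x y, close r (val x) (val y) -> close e (val (act g x)) (val (act g y)).
  apply: exists_uniform => [g r r' rr _ H x y xy|g _].
    by apply: H; exact: close_le xy.
  exact: sphere_uniformly_continuous.
exists r => // t tr g _ _ /mapP[_ /mapP[x xt ->] ->] /mapP[_ /mapP[y yt ->] ->].
by apply: (rP g); [rewrite mem_enum|apply: tr; exact: map_f].
Qed.

Lemma sphere_acyclic_type (e : R) : 0 < e -> exists2 r, 0 < r &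
  forall m (z : chain F X), (m < n)%N ->
    (forall a, a \in z -> size a.2 = m.+1 /\ small r (map val a.2)) ->
    (forall f, pairing (cobound f) z = 0) ->
  exists2 y : chain F X,
    forall a, a \in y -> size a.2 = m.+2 /\ small e (map val a.2) &
    forall f, pairing (cobound f) y = pairing f z.
Proof.
move=> /(sphere_acyclic F n)[r r0 rP]; exists r => // m z mn zP z0.
have [||y yP yE] := rP m (map_chain val z) mn.
- move=> _ /mem_map_chain[b /zP[sb rb] ->]; rewrite size_map; split=> //.
  by move=> _ /mapP[x _ ->]; exact: dot_sphere.
- move=> f; rewrite pairing_map -[RHS](z0 (fun t => f (map val t))).
  by apply: eq_pairing => t; rewrite cobound_map.
exists (map_chain (insubd x0) y).
  move=> _ /mem_map_chain[b /yP[sb eb b1] ->]; rewrite size_map; split=> //.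
  rewrite -map_comp map_id_in // => x /b1 x1; rewrite /= insubdK //.
  apply/mem_set; rewrite /sphere /= -[RHS]x1.
  by apply: eq_bigr => i _; rewrite expr2.
move=> f; rewrite pairing_map.
transitivity (pairing (cobound (fun t => f (map (insubd x0) t))) y).
  by apply: eq_pairing => t; rewrite cobound_map.
rewrite yE pairing_map; apply: eq_pairing => t.
by rewrite -map_comp map_id_in // => x _; rewrite /= valKd.
Qed.

(** The chain [c k.+1] fills the image of [c k] under a group ring element, a cycle because
    consecutive elements multiply to zero. Sizes are chosen from the top down: the lower chains must
    be small enough to admit an [e1]-small filling. *)
Lemma exists_resolution k (e : R) : (k <= n)%N -> 0 < e ->
  exists c, resolution (F := F) act x0 (orbit_small e) k c.
Proof.
elim: k e => [|k IH] e kn e0.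
  exists (fun=> [:: (1, [:: x0])]); split=> // k a.
    by rewrite leqn0 inE => /eqP -> /eqP ->.
  move=> _; rewrite inE => /eqP -> g x y; rewrite !inE => /eqP -> /eqP -> i.
  by rewrite subrr normr0 ltW.
have [e1 e10 e1P] := small_orbit_small e0.
have [r r0 rP] := sphere_acyclic_type e10.
have m0 : 0 < Order.min e r by rewrite lt_min e0.
have [c cP] := IH _ (ltnW kn) m0.
have [||y yP yE] := rP k (group_ring_chain act (odd k.+1) (c k)) kn.
- move=> a /(mem_group_ring_chain actP)[g [b bc ->]].
  rewrite size_map (resolution_size cP _ bc) //; split=> //.
  have := resolution_in cP (leqnn k) bc g; apply: small_le.
  by rewrite ge_min lexx orbT.
- move=> f; rewrite pairing_group_ring_chain.
  rewrite -(eq_pairing _ (group_ring_op_cobound act (odd k.+1) f)).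
  case: k {IH rP} kn cP => [|k] kn cP.
    by rewrite (resolution0 cP) pairing_cons pairing_nil /= subrr subr0 mulr0 addr0.
  rewrite (resolution_bound cP) // /pairing big1 // => a _ /=.
  by rewrite (norm_diff actP) mulr0.
exists (fun i => if (i <= k)%N then c i else y); split.
- by rewrite leq0n (resolution0 cP).
- move=> i a ik; case: leqP => [ik'|ki] aP; first exact: (resolution_size cP ik' aP).
  have [-> _] := yP a aP; have -> : i = k.+1 by apply/eqP; rewrite eqn_leq ik ki.
  by [].
- move=> i a ik; case: leqP => [ik'|ki] aP.
    by apply: orbit_small_le (resolution_in cP ik' aP); rewrite ge_min lexx.
  by have [_] := yP a aP; exact: e1P.
- move=> i f ik; rewrite -[(i <= k)%N]/(i < k.+1)%N ik.
  case: ltnP => [ik'|ki]; first exact: (resolution_bound cP).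
  have -> : i = k by apply/eqP; rewrite eqn_leq -ltnS ik ki.
  by rewrite yE pairing_group_ring_chain.
Qed.

End SphereResolution.

(** * Translates of closed sets under the action *)

Section Translates.
Variables (R : realType) (p d n : nat).
Local Notation X := (sphere R n).
Local Notation V := ('I_d * 'Z_p)%type.
Variable (to : {action 'Z_p &-> X}).

Lemma Zp_action_of : Zp_action (fun g (x : X) => to x g).
Proof.
have [to_inj toM] : is_action [set: 'Z_p]%SET to by case: (to).
have {}toM g h x : to x (g + h) = to (to x h) g.
  by rewrite addrC; apply: toM; rewrite inE.
split=> [x|g h x]; last exact: toM.
by apply: (to_inj 0); rewrite -toM addr0.
Qed.

Let act (g : 'Z_p) (x : X) : X := to x g.

Lemma translateE (g : 'Z_p) (B : set X) x : translate to g B x <-> B (act (- g) x).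
Proof.
have actP := Zp_action_of; split=> [[y By <-]|Bx].
  by rewrite /act (Zp_actK actP).
by exists (act (- g) x) => //; rewrite -[RHS](Zp_actK actP (- g)) opprK.
Qed.

Lemma iter_translate (g : 'Z_p) k (B : set X) :
  iter k (translate to g) B = translate to (g *+ k) B.
Proof.
have actP := Zp_action_of.
elim: k => [|k IH] /=; apply/seteqP; split=> x.
- by move=> Bx; apply/translateE; rewrite oppr0 /act actP.1.
- by move=> /translateE; rewrite oppr0 /act actP.1.
- rewrite IH => /translateE/translateE; rewrite /act -actP.2 => Bx.
  by apply/translateE; rewrite /act mulrS opprD addrC.
- move=> /translateE Bx; rewrite IH; apply/translateE/translateE.
  by move: Bx; rewrite /act -actP.2 mulrS opprD addrC.
Qed.

Lemma closed_translate g (B : set X) : continuous_action to ->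
  closed B -> closed (translate to g B).
Proof.
move=> toc Bc; have -> : translate to g B = act (- g) @^-1` B.
  by apply/seteqP; split=> x /translateE.
by apply: closed_comp => // x _; exact: toc.
Qed.

End Translates.

Lemma generator_unit (p : nat) (s : 'Z_p) : prime p -> generator (Zp p) s ->
  s \is a GRing.unit.
Proof.
move=> p_prime gs; have p1 := prime_gt1 p_prime.
apply: Zp_unit => //; apply/eqP => s0.
move: gs; rewrite s0 /generator => /eqP /(congr1 (fun S : {set 'Z_p} => #|S|)).
by rewrite (card_Zp (ltnW p1)) cycle1 cards1 => p1E; rewrite p1E in p1.
Qed.

(** * Equivariant labels, choice of the mesh, and the common point *)

Theorem theorem6p6 (R : realType) (p d n : nat) (hp : prime p) (hd : (1 <= d)%N)
  (hn : n = ((p - 1) * d - 1)%N)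
  (to : {action 'Z_p &-> sphere R n})
  (to_cont : continuous_action to)
  (to_free : free_action to)
  (s : 'Z_p) (hs : generator (Zp p) s)
  (A : 'I_d -> 'I_n.+1 -> set (sphere R n))
  (A_closed : forall (i : 'I_d) (j : 'I_n.+1), closed (A i j))
  (A_cover : forall j : 'I_n.+1,
    \bigcup_(i : 'I_d) \bigcup_(g : 'Z_p) translate to g (A i j) = setT)
  (A_disj : forall (i : 'I_d) (j : 'I_p -> 'I_n.+1), injective j ->
    \bigcap_(k : 'I_p) iter k.+1 (translate to s) (A i (j k)) = set0)
  (t : 'I_d -> 'Z_p) :
  exists2 pi : 'I_d * 'Z_p -> 'I_n.+1,
    set_bij [set x : 'I_d * 'Z_p | x.2 != t x.1] setT pi &
    (\bigcap_(i : 'I_d) \bigcap_(g in [set g : 'Z_p | g != t i])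
       translate to g (A i (pi (i, g)))) !=set0.
Proof.
have p_gt1 := prime_gt1 hp.
have nE : n.+1 = (d * (p - 1))%N.
  by rewrite hn mulnC subn1 prednK // muln_gt0 hd subn_gt0.
have pZ : p%:R = 0 :> 'Z_p by exact: pchar_Zp.
pose act (g : 'Z_p) (x : sphere R n) : sphere R n := to x g.
have actP : Zp_action act := Zp_action_of to.
have act_cont g : continuous (act g) := to_cont g.
have S0 : sphere R n (delta_mx ord0 ord0).
  rewrite /sphere /= (bigD1 ord0) //= big1 => [|i i0]; rewrite mxE.
    by rewrite !eqxx expr1n addr0.
  by rewrite (negPf i0) andbF expr0n.
pose x0 : sphere R n := SigSub (mem_set S0).
have [phase phaseE] : exists phase : sphere R n -> 'Z_p,
    forall g x, phase (act g x) = phase x + g.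
  have [||phase phaseE] := exists_phase actP (P := fun=> True) x0 => //.
    by move=> g x _ gx; apply/eqP; apply: contraT => /(to_free _ x).
  by exists phase => g x; exact: phaseE.
have /choice[pick0 pick0P] : forall jx : 'I_n.+1 * sphere R n,
    exists v : 'I_d * 'Z_p, translate to v.2 (A v.1 jx.1) jx.2.
  move=> [j x]; have : setT x by [].
  by rewrite -(A_cover j) => -[i _ [g _ Ax]]; exists (i, g).
(* The point is moved to phase 0 and labelled there by an arbitrary choice, and the label is moved
   back; this makes the labelling equivariant. *)
pose label (j : nat) x : 'I_d * 'Z_p :=
  shift (phase x) (pick0 (inord j, act (- phase x) x)).
have label_shift j g x : label j (act g x) = shift g (label j x).
  rewrite /label phaseE -actP.2 opprD subrK.
  by rewrite addrC (Zp_action_shift p d).2.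
have labelP (j : 'I_n.+1) x : translate to (label j x).2 (A (label j x).1 j) x.
  have := pick0P (j, act (- phase x) x); rewrite /label inord_val /=.
  move=> /translateE; rewrite -/(act _ _) -actP.2 => Ax; apply/translateE.
  by rewrite /= opprD.
(* A common Lebesgue number for the finitely many empty [p]-fold intersections; families [j] that
   are not injective get the default 1. *)
have [e1 e10 e1P] : exists2 e, 0 < e &
    forall ij : 'I_d * {ffun 'I_p -> 'I_n.+1}, ij \in enum predT -> injective ij.2 ->
    forall x : 'I_p -> sphere R n,
    (forall k : 'I_p, translate to (s *+ k.+1) (A ij.1 (ij.2 k)) (x k)) ->
    ~ (forall k l, close e (val (x k)) (val (x l))).
  apply: exists_uniform => [ij r r' rr _ H inj x xA xr|[i j] _].
    by apply: (H inj x xA) => k l; exact: close_le (xr k l).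
  case: (pselect (injective j)) => jinj; last by exists 1.
  have [||r r0 rP] := @sphere_lebesgue R n _
      (fun k : 'I_p => iter k.+1 (translate to s) (A i (j k))) x0.
  - by move=> k; rewrite iter_translate; apply: closed_translate.
  - exact: A_disj.
  - by exists r => // _ x xA; apply: rP => k; rewrite iter_translate; exact: xA.
(* For an omitted vertex, with [v.2 = t v.1], the set is the whole sphere, so the family can be
   indexed by all pairs. *)
pose B (pi : {ffun 'I_d * 'Z_p -> 'I_n.+1}) (v : 'I_d * 'Z_p) : set (sphere R n) :=
  [set x | v.2 != t v.1 -> translate to v.2 (A v.1 (pi v)) x].
have [e2 e20 e2P] : exists2 e, 0 < e &
    forall pi, pi \in enum predT -> \bigcap_v B pi v = set0 ->
    forall x, (forall v, B pi v (x v)) ->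
    ~ (forall v w, close e (val (x v)) (val (x w))).
  apply: exists_uniform => [pi r r' rr _ H B0 x xB xr|pi _].
    by apply: (H B0 x xB) => v w; exact: close_le (xr v w).
  case: (pselect (\bigcap_v B pi v = set0)) => B0; last by exists 1.
  have [||r r0 rP] := @sphere_lebesgue R n _ (B pi) x0 => //; last by exists r.
  move=> v; rewrite /B; case: (v.2 != t v.1).
    rewrite (_ : [set x | _] = translate to v.2 (A v.1 (pi v))).
      exact: closed_translate.
    by apply/seteqP; split=> x Hx; [exact: Hx|move=> _].
  by rewrite (_ : [set x | _] = setT) //; apply/seteqP; split=> x.
pose e := Order.min e1 e2.
have e0 : 0 < e by rewrite lt_min e10.
have [c cP] := exists_resolution 'Z_p x0 actP act_cont (leqnn n) e0.
have P_join k u g y : (k <= n)%N -> orbit_small act e u ->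
    (forall j, (j < k.+1)%N -> y j \in map (act g) u) ->
    join_simplex [seq label j (y j) | j <- iota 0 k.+1].
  move=> kn ue yu; apply: contrapT => /existsNP[i nproper].
  (* If all labels [(i, h)] occur, they do so at distinct indices [j0 h], since an index carries one
     label; close points would then lie in [p] sets with empty intersection. *)
  have /choice[j0 j0P] : forall h : 'Z_p, exists j,
    (j < k.+1)%N /\ label j (y j) = (i, h).
    move=> h; apply: contrapT => H; apply: nproper; exists h.
    apply/mapP => -[j]; rewrite mem_iota add0n => /andP[_ jk] E; apply: H.
    by exists j; rewrite E.
  have j0n h : (j0 h < n.+1)%N by have [jk _] := j0P h; exact: leq_trans jk _.
  (* The exponents 1 to [p] of [s] are written [l.+1] with [l : 'I_p]; they give distinct elements
     because a generator is a unit of ['Z_p]. *)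
  pose jj : {ffun 'I_p -> 'I_n.+1} := [ffun l : 'I_p => inord (j0 (s *+ l.+1))].
  have jjE l : jj l = j0 (s *+ l.+1) :> nat by rewrite ffunE inordK.
  apply: (e1P (i, jj) _ _ (fun l => y (j0 (s *+ l.+1)))) => //=.
  - by rewrite mem_enum.
  - move=> k1 k2 /(congr1 val); rewrite /= !jjE => jE.
    have [_ E1] := j0P (s *+ k1.+1); have [_ E2] := j0P (s *+ k2.+1).
    move: E1; rewrite jE E2 => -[/eqP].
    rewrite -[s *+ _]mulr_natr -[s *+ k1.+1]mulr_natr.
    move=> /eqP/(mulrI (generator_unit hp hs)).
    rewrite -!natr1 => /addIr /(congr1 val).
    by rewrite /= !val_Zp_nat // !modn_small // => /val_inj.
  - move=> l; have [_ E] := j0P (s *+ l.+1).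
    by have := labelP (jj l) (y (j0 (s *+ l.+1))); rewrite jjE E.
  - move=> k1 k2; apply: (@close_le _ _ e); first by rewrite ge_min lexx.
    have [jk1 _] := j0P (s *+ k1.+1); have [jk2 _] := j0P (s *+ k2.+1).
    by apply: (ue g); apply: map_f; exact: yu.
have [u [g [y [ue yu ft]]]] :=
  exists_simplex_on_facet hp pZ actP nE label_shift cP P_join t.
set w := [seq _ | _ <- _] in ft.
have sw : size w = n.+1 by rewrite size_map size_iota.
have uw : uniq w by apply: (facet_uniq hp _ ft); rewrite sw.
have wnth (j : 'I_n.+1) v : nth v w j = label j (y j).
  by rewrite (nth_map 0%N) ?size_iota // nth_iota.
move/facetP: ft => ft.
have idx v : v.2 != t v.1 -> (index v w < n.+1)%N.
  by rewrite -sw index_mem ft.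
(* The position of [v] in the word of labels; off the facet the value is arbitrary. *)
pose pi : {ffun 'I_d * 'Z_p -> 'I_n.+1} := [ffun v => inord (index v w)].
have piE v : v.2 != t v.1 -> pi v = index v w :> nat.
  by move=> vt; rewrite ffunE inordK // idx.
exists pi.
  split=> //.
  - move=> v1 v2; rewrite !inE /= => t1 t2 /(congr1 val).
    by rewrite /= !piE // => /index_inj; apply; rewrite ?ft //; exact: v1.
  - move=> j _; have jw : (j < size w)%N by rewrite sw.
    have vw := mem_nth (label j (y j)) jw.
    exists (nth (label j (y j)) w j); first by rewrite /= -ft.
    by apply: val_inj; rewrite /= piE -?ft // index_uniq.
(* An empty intersection is excluded by the close points [y (pi v)], since [e2] was chosen uniformly
   for all maps [pi]. *)
apply/set0P/eqP => cap0.
apply: (e2P pi _ _ (fun v => y (pi v))) => //.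
- by rewrite mem_enum.
- rewrite -subset0 -cap0 => x Bx i _ h ht.
  exact: (Bx (i, h)).
- move=> v vt; have := labelP (pi v) (y (pi v)).
  by rewrite -(wnth _ v) piE // nth_index ?ft.
- move=> v1 v2; apply: (@close_le _ _ e); first by rewrite ge_min lexx orbT.
  by apply: (ue g); apply: map_f; apply: yu; rewrite -ltnS.
Qed.
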